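(* Let $p,q,r$ be primes with $q\mid p-1$ and $q\mid r-1$, $G=G_1\times G_2$, $H\subseteq G$ a subgroup with $H\cong\mathbb Z_q\times\mathbb Z_q$, $\omega$ a 2-cocycle on $\widehat H$ with nontrivial cohomology class, and $A=(kG)^J$ with $J=\sum_{\alpha,\beta\in\widehat H}\omega(\alpha,\beta)e_\alpha\otimes e_\beta$. Then $A$ (a semisimple Hopf algebra of dimension $prq^2$) is simple as a Hopf algebra.
   Context: $k$ is an algebraically closed field of characteristic zero. $G_1=\mathbb Z_p\rtimes\mathbb Z_q$ and $G_2=\mathbb Z_r\rtimes\mathbb Z_q$ denote the unique nonabelian groups of orders $pq$ and $rq$ ($p=r$ allowed). For a twist $J$ in a Hopf algebra $A$, $A^J$ is the Hopf algebra with the same algebra and counit, comultiplication $\Delta^J(h)=J^{-1}\Delta(h)J$ and twisted antipode. For an abelian subgroup $H$ of a finite group $G$, $\widehat H$ is its character group and $e_\chi=\frac{1}{|H|}\sum_{h\in H}\chi(h^{-1})h$; for a 2-cocycle $\omega$ on $\widehat H$, $J=\sum\omega(\alpha,\beta)e_\alpha\otimes e_\beta$ is a twist in $kG$. A Hopf algebra is simple if it has no normal Hopf subalgebras (stable under ${}^hx=\sum h_1xS(h_2)$) other than $k$ and itself. *)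

(* Defs.v *)
From HB Require Import structures.
From mathcomp Require Import all_boot all_order all_algebra all_fingroup all_solvable.
Set Implicit Arguments. Unset Strict Implicit. Unset Printing Implicit Defensive.
Import GRing.Theory.
Local Open Scope ring_scope.

(* The group algebra kG of a finite group gT (the whole type) is modelled as
   {ffun gT -> k} (coefficients w.r.t. the basis of group elements), and
   kG (x) kG as {ffun gT * gT -> k}. *)

Section HopfTwist.
Variables (k : fieldType) (gT : finGroupType).

Definition kG := {ffun gT -> k}.
Definition kG2 := {ffun gT * gT -> k}.

Definition gdelta (g : gT) : kG := [ffun x => (x == g)%:R].
Definition kG_one : kG := gdelta 1%g.
Definition kG_add (a b : kG) : kG := [ffun g => a g + b g].
Definition kG_scale (c : k) (a : kG) : kG := [ffun g => c * a g].
Definition kG_zero : kG := [ffun _ => 0].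
Definition kG_mul (a b : kG) : kG := [ffun g => \sum_(h : gT) a h * b (h^-1 * g)%g].

Definition kG2_mul (T U : kG2) : kG2 :=
  [ffun gh => \sum_(x : gT * gT) T x * U ((x.1)^-1 * gh.1, (x.2)^-1 * gh.2)%g].
Definition kG2_one : kG2 := [ffun gh => ((gh.1 == 1%g) && (gh.2 == 1%g))%:R].

Definition Delta (a : kG) : kG2 := [ffun gh => if gh.1 == gh.2 then a gh.1 else 0].
Definition eps (a : kG) : k := \sum_(g : gT) a g.

Definition DeltaJ (J Jinv : kG2) (a : kG) : kG2 := kG2_mul Jinv (kG2_mul (Delta a) J).

Definition linext (S : gT -> kG) (a : kG) : kG :=
  [ffun x => \sum_(g : gT) a g * S g x].

Definition mSid (S : gT -> kG) (T : kG2) : kG :=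
  [ffun x => \sum_(gh : gT * gT) T gh * kG_mul (S gh.1) (gdelta gh.2) x].
Definition midS (S : gT -> kG) (T : kG2) : kG :=
  [ffun x => \sum_(gh : gT * gT) T gh * kG_mul (gdelta gh.1) (S gh.2) x].

(* S (given on the basis, extended linearly) is an antipode of the bialgebra
   (kG, mult, Delta^J, eps) *)
Definition is_antipode (J Jinv : kG2) (S : gT -> kG) : Prop :=
  forall a : kG,
    mSid S (DeltaJ J Jinv a) = kG_scale (eps a) kG_one /\
    midS S (DeltaJ J Jinv a) = kG_scale (eps a) kG_one.

Definition adj (J Jinv : kG2) (S : gT -> kG) (a x : kG) : kG :=
  [ffun y => \sum_(gh : gT * gT)
     DeltaJ J Jinv a gh * kG_mul (kG_mul (gdelta gh.1) x) (S gh.2) y].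

Definition in_tensor2 (B : kG -> Prop) (T : kG2) : Prop :=
  exists n (b c : 'I_n -> kG), (forall i, B (b i) /\ B (c i)) /\
    T = [ffun gh => \sum_(i < n) b i gh.1 * c i gh.2].

Definition is_hopf_subalgebra (J Jinv : kG2) (S : gT -> kG) (B : kG -> Prop) : Prop :=
  [/\ (B kG_zero /\
       (forall a b, B a -> B b -> B (kG_add a b)) /\
       (forall c a, B a -> B (kG_scale c a))),
      B kG_one,
      (forall a b, B a -> B b -> B (kG_mul a b)),
      (forall a, B a -> in_tensor2 B (DeltaJ J Jinv a)) &
      (forall a, B a -> B (linext S a))].

Definition is_normal_hopf_subalgebra (J Jinv : kG2) (S : gT -> kG) (B : kG -> Prop) :=
  is_hopf_subalgebra J Jinv S B /\ forall a x, B x -> B (adj J Jinv S a x).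

Definition hopf_simple (J Jinv : kG2) (S : gT -> kG) : Prop :=
  forall B : kG -> Prop, is_normal_hopf_subalgebra J Jinv S B ->
    (forall a, B a <-> exists c, a = kG_scale c kG_one) \/ (forall a, B a).

Definition is_character (H : {set gT}) (a : gT -> k) : Prop :=
  {in H &, forall x y, a (x * y)%g = a x * a y} /\ {in H, forall x, a x != 0}.

(* chi : X -> (gT -> k) identifies the finite group X with the character group
   \hat H (group isomorphism onto the set of characters of H, pointwise product) *)
Definition dual_group_param (H : {set gT}) (X : finGroupType) (chi : X -> gT -> k) : Prop :=
  [/\ (forall x, is_character H (chi x)),
      (forall x y, {in H, forall h, chi (x * y)%g h = chi x h * chi y h}),
      (forall x y, {in H, forall h, chi x h = chi y h} -> x = y) &
      (forall a, is_character H a -> exists x, {in H, forall h, chi x h = a h})].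

Definition e_idem (H : {set gT}) (a : gT -> k) : kG :=
  [ffun g => if g \in H then (#|H|%:R)^-1 * a (g^-1)%g else 0].

Definition twistJ (H : {set gT}) (X : finGroupType) (chi : X -> gT -> k)
  (omega : X -> X -> k) : kG2 :=
  [ffun gh => \sum_(x : X) \sum_(y : X)
      omega x y * e_idem H (chi x) gh.1 * e_idem H (chi y) gh.2].

End HopfTwist.

Definition is_2cocycle (k : fieldType) (X : finGroupType) (omega : X -> X -> k) : Prop :=
  (forall x y, omega x y != 0) /\
  (forall x y z, omega x y * omega (x * y)%g z = omega y z * omega x (y * z)%g).

Definition is_2coboundary (k : fieldType) (X : finGroupType) (omega : X -> X -> k) : Prop :=
  exists f : X -> k, (forall x, f x != 0) /\
    (forall x y, omega x y = f x * f y / f (x * y)%g).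

(* Main.v *)
Require Import Defs.
From HB Require Import structures.
From mathcomp Require Import all_boot all_order all_algebra all_fingroup all_solvable.
From mathcomp Require Import boolp zify ring.
Set Implicit Arguments. Unset Strict Implicit. Unset Printing Implicit Defensive.
Import GRing.Theory.
Local Open Scope ring_scope.

(* Let [B] be a normal Hopf subalgebra of [A = (kG)^J].  The ideal [B^+ A] is
   also a coideal for the untwisted coproduct, because conjugation by [J]
   preserves ideals; hence it is the kernel of [kG -> k(G/N)] for a normal
   subgroup [N].  Dually, the functions on [G] that kill it form a
   translation-invariant algebra of functions, and [N] is read off from these.
   If [N = 1], then [B = k].  If [N = G], an integral of [B] (built as a trace,
   using [S^2 = id]) is a multiple of the sum of all group elements, whose
   twisted coproduct is nondegenerate, so [B = A].
   Otherwise, let [y] be a character of [H] trivial on the intersection of [H]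
   and [N].  Slicing [Delta(b) J = J Delta^J(b)] on either side with an extension
   of [y] to [HN] shows that [B] commutes with the element [t] of [H] dual to [y]
   under the alternating bicharacter of the cocycle.  Then
   [Delta(b) = J Delta^J(b) J^-1] commutes with [t (x) 1], so [b] is supported on
   the centralizer of [t], and therefore [t] centralizes [N].  The bicharacter is
   nondegenerate because a symmetric cocycle with values in an algebraically
   closed field is a coboundary; but in [G1 x G2] no such family of elements [t]
   of [H] can centralize a nontrivial proper normal subgroup. *)

(** * The group algebra *)

Section GroupAlgebra.
Variable k : fieldType.

(* An alias of [kG]: the bare function type already carries the pointwise
   product, whereas [galg] gets the convolution product. *)
Definition galg (gT : finGroupType) := {ffun gT -> k}.

Section Structure.
Variable gT : finGroupType.
HB.instance Definition _ := Vector.copy (galg gT) {ffun gT -> k^o}.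

Definition gone : galg gT := gdelta k 1%g.
Definition gmul (a b : galg gT) : galg gT := kG_mul a b.

Lemma gmulA : associative gmul.
Proof.
move=> a b c; apply/ffunP => g; rewrite !ffunE.
under eq_bigr => h _ do rewrite ffunE mulr_sumr.
under [RHS]eq_bigr => h _ do rewrite ffunE mulr_suml.
rewrite [RHS]exchange_big /=; apply: eq_bigr => h _.
rewrite (reindex_inj (mulgI h^-1%g)) /=; apply: eq_bigr => x _.
by rewrite mulrA invMg invgK -mulgA mulKVg.
Qed.

Lemma gmul1l : left_id gone gmul.
Proof.
move=> a; apply/ffunP => g; rewrite ffunE (bigD1 1%g) //= big1 ?addr0.
  by rewrite ffunE eqxx mul1r invg1 mul1g.
by move=> h /negbTE h1; rewrite ffunE h1 mul0r.
Qed.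

Lemma gmul1r : right_id gone gmul.
Proof.
move=> a; apply/ffunP => g; rewrite ffunE (bigD1 g) //= big1 ?addr0.
  by rewrite ffunE mulVg eqxx mulr1.
by move=> h hg; rewrite ffunE -eq_mulVg1 (negbTE hg) mulr0.
Qed.

Lemma gmulDl : left_distributive gmul +%R.
Proof.
move=> a b c; apply/ffunP => g; rewrite !ffunE -big_split /=.
by apply: eq_bigr => h _; rewrite !ffunE mulrDl.
Qed.

Lemma gmulDr : right_distributive gmul +%R.
Proof.
move=> a b c; apply/ffunP => g; rewrite !ffunE -big_split /=.
by apply: eq_bigr => h _; rewrite !ffunE mulrDr.
Qed.

Lemma gone_neq0 : gone != 0.
Proof.
by apply/eqP => /ffunP /(_ 1%g); rewrite !ffunE eqxx => /eqP; rewrite oner_eq0.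
Qed.

HB.instance Definition _ := GRing.Zmodule_isNzRing.Build (galg gT)
  gmulA gmul1l gmul1r gmulDl gmulDr gone_neq0.

Lemma gscaleAl (c : k) (a b : galg gT) : c *: (a * b) = (c *: a) * b.
Proof.
apply/ffunP => g; rewrite !ffunE /GRing.scale /= mulr_sumr.
by apply: eq_bigr => h _; rewrite !ffunE mulrA.
Qed.
HB.instance Definition _ := GRing.Lmodule_isLalgebra.Build k (galg gT) gscaleAl.

Lemma gscaleAr (c : k) (a b : galg gT) : c *: (a * b) = a * (c *: b).
Proof.
apply/ffunP => g; rewrite !ffunE /GRing.scale /= mulr_sumr.
by apply: eq_bigr => h _; rewrite !ffunE mulrCA.
Qed.
HB.instance Definition _ := GRing.Lalgebra_isAlgebra.Build k (galg gT) gscaleAr.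

Definition gel (g : gT) : galg gT := gdelta k g.

Lemma galgZE (c : k) (a : galg gT) g : (c *: a) g = c * a g.
Proof. by rewrite ffunE. Qed.

Lemma galg_sumE I r (P : pred I) (F : I -> galg gT) g :
  (\sum_(i <- r | P i) F i) g = \sum_(i <- r | P i) F i g.
Proof. by rewrite sum_ffunE. Qed.

Lemma gelE g h : gel g h = (h == g)%:R. Proof. by rewrite ffunE. Qed.

Lemma gel1 : gel 1 = 1. Proof. by []. Qed.

Lemma gelM g h : gel (g * h) = gel g * gel h.
Proof.
apply/ffunP => x; rewrite [RHS]ffunE (bigD1 g) //= big1 ?addr0.
  by rewrite !gelE eqxx mul1r -(inj_eq (mulgI g) (_ * _)%g) mulKVg.
by move=> y /negbTE yg; rewrite gelE yg mul0r.
Qed.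

Lemma galg_expand (a : galg gT) : a = \sum_g a g *: gel g.
Proof.
apply/ffunP => x; rewrite galg_sumE (bigD1 x) //= big1 ?addr0.
  by rewrite galgZE gelE eqxx mulr1.
by move=> y yx; rewrite galgZE gelE eq_sym (negbTE yx) mulr0.
Qed.

End Structure.

Section LinearExtension.
Variables (gT : finGroupType) (V : lmodType k).
Implicit Type f : gT -> V.

(** For [V = k^o] this is the pairing identifying functions on the group with the linear dual of the
    group algebra; applied to a coproduct it plays the role of Sweedler notation. *)
Definition lext f (a : galg gT) : V := \sum_g a g *: f g.

Lemma lext_linear f : linear (lext f).
Proof.
move=> c a b; rewrite /lext scaler_sumr -big_split /=; apply: eq_bigr => g _.
by rewrite ffunE galgZE scalerDl scalerA.
Qed.
HB.instance Definition _ f := GRing.isLinear.Build k (galg gT) V _ (lext f) (lext_linear f).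

Lemma lext_gel f g : lext f (gel g) = f g.
Proof.
rewrite /lext (bigD1 g) //= big1 ?addr0; first by rewrite gelE eqxx scale1r.
by move=> h /negbTE hg; rewrite gelE hg scale0r.
Qed.

Lemma linear_gel_eq (F F' : {linear galg gT -> V}) :
  (forall g, F (gel g) = F' (gel g)) -> F =1 F'.
Proof.
move=> FF a; rewrite [a]galg_expand !linear_sum; apply: eq_bigr => g _.
by rewrite !linearZ FF.
Qed.

End LinearExtension.

End GroupAlgebra.

(** * Functoriality, tensor squares and the untwisted coproduct *)

Section TensorSquare.
Variable k : fieldType.

Section Pushforward.
Variables (gT hT : finGroupType) (phi : gT -> hT).

(** The coproduct, the antipode of [kG], the flip, the counit on one leg and reassociation are all
    push-forwards along maps between finite groups. *)
Definition pushf : galg k gT -> galg k hT := lext (fun g => gel k (phi g)).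
HB.instance Definition _ := GRing.Linear.on pushf.

Lemma pushf_gel g : pushf (gel k g) = gel k (phi g).
Proof. exact: lext_gel. Qed.

Lemma pushf_inj (a : galg k gT) g : injective phi -> pushf a (phi g) = a g.
Proof.
move=> phi_inj; rewrite /pushf /lext galg_sumE (bigD1 g) //= galgZE gelE eqxx mulr1.
by rewrite big1 ?addr0 // => h hg; rewrite galgZE gelE inj_eq // eq_sym (negbTE hg) mulr0.
Qed.

Hypothesis phiM : {morph phi : x y / (x * y)%g}.

Lemma pushfM : {morph pushf : a b / a * b}.
Proof.
move=> a b; rewrite [a]galg_expand [b]galg_expand.
rewrite mulr_suml !linear_sum mulr_suml; apply: eq_bigr => g _.
rewrite mulr_sumr !linear_sum mulr_sumr; apply: eq_bigr => h _.
rewrite -scalerAl -scalerAr !linearZ /= -gelM !pushf_gel phiM gelM.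
by rewrite -!scalerAl -!scalerAr.
Qed.

Lemma pushf1 : pushf 1 = 1.
Proof.
rewrite -gel1 pushf_gel -gel1; congr gel.
by apply: (@mulgI _ (phi 1)); rewrite -phiM !mulg1.
Qed.

End Pushforward.

Lemma pushf_comp (gT hT lT : finGroupType) (phi : hT -> lT) (psi : gT -> hT) a :
  pushf phi (pushf psi a) = pushf (phi \o psi) a.
Proof.
apply: (linear_gel_eq (F := pushf phi \o pushf psi) (F' := pushf (phi \o psi))) a => g /=.
by rewrite !pushf_gel.
Qed.

Section Tensor.
Variables (gT hT : finGroupType).

(** The tensor product is modelled by the group algebra of the product group, whose convolution is
    the tensor product multiplication. *)
Definition tens (a : galg k gT) (b : galg k hT) : galg k (gT * hT)%type :=
  [ffun x => a x.1 * b x.2].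

Lemma tensE a b x : tens a b x = a x.1 * b x.2. Proof. by rewrite ffunE. Qed.

Lemma tens_linear_l b : linear (tens^~ b).
Proof. by move=> c a a'; apply/ffunP => x; rewrite !ffunE /GRing.scale /= mulrDl mulrA. Qed.
Lemma tens_linear_r a : linear (tens a).
Proof. by move=> c b b'; apply/ffunP => x; rewrite !ffunE /GRing.scale /= mulrDr mulrCA. Qed.
HB.instance Definition _ a := GRing.isLinear.Build k _ _ _ (tens a) (tens_linear_r a).

Lemma tens_suml I r (P : pred I) (F : I -> galg k gT) b :
  tens (\sum_(i <- r | P i) F i) b = \sum_(i <- r | P i) tens (F i) b.
Proof.
apply/ffunP => x; rewrite ffunE !galg_sumE mulr_suml.
by apply: eq_bigr => i _; rewrite ffunE.
Qed.

Lemma tens_sumr I r (P : pred I) a (F : I -> galg k hT) :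
  tens a (\sum_(i <- r | P i) F i) = \sum_(i <- r | P i) tens a (F i).
Proof. exact: linear_sum. Qed.

Lemma tensZl c a b : tens (c *: a) b = c *: tens a b.
Proof. by apply/ffunP => x; rewrite !ffunE /GRing.scale /= mulrA. Qed.

Lemma tensZr c a b : tens a (c *: b) = c *: tens a b.
Proof. exact: linearZ. Qed.

Lemma tens_gel g h : tens (gel k g) (gel k h) = gel k (g, h).
Proof.
apply/ffunP => -[x y]; rewrite tensE !gelE xpair_eqE.
by do 2!case: eqP; rewrite ?mulr1 ?mulr0.
Qed.

Lemma tens1 : tens 1 1 = 1. Proof. exact: tens_gel. Qed.

Lemma tensM a b c d : tens a b * tens c d = tens (a * c) (b * d).
Proof.
apply/ffunP => -[x y]; rewrite tensE !ffunE big_distrlr /= pair_bigA /=.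
by apply: eq_bigr => -[g h] _; rewrite !ffunE mulrACA.
Qed.

Lemma lext_tens (V : lmodType k) (f : gT * hT -> V) a b :
  lext f (tens a b) = lext (fun g => lext (fun h => f (g, h)) b) a.
Proof.
rewrite /lext; under [RHS]eq_bigr => g _ do rewrite scaler_sumr.
rewrite pair_bigA; apply: eq_bigr => -[g h] _ /=.
by rewrite tensE scalerA.
Qed.

End Tensor.

Section Coproduct.
Variable gT : finGroupType.
Local Notation A := (galg k gT).
Local Notation A2 := (galg k (gT * gT)%type).

Definition cop : A -> A2 := pushf (fun g => (g, g)).
HB.instance Definition _ := GRing.Linear.on cop.

Lemma cop_gel g : cop (gel k g) = gel k (g, g). Proof. exact: pushf_gel. Qed.
Lemma copM : {morph cop : a b / a * b}. Proof. exact: pushfM. Qed.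
Lemma cop1 : cop 1 = 1. Proof. exact: pushf1. Qed.

Lemma copE a : cop a = Delta a.
Proof.
apply/ffunP => -[x y]; rewrite /cop /pushf /lext galg_sumE ffunE /= (bigD1 x) //=.
rewrite galgZE gelE xpair_eqE eqxx /= big1 ?addr0.
  by rewrite eq_sym; case: eqP; rewrite ?mulr1 ?mulr0.
move=> g; rewrite galgZE gelE xpair_eqE eq_sym => /negbTE ->.
by rewrite mulr0.
Qed.

Lemma kG2_mulE (T U : kG2 k gT) : kG2_mul T U = (T : A2) * U.
Proof. by []. Qed.

Lemma kG2_oneE : kG2_one k gT = 1 :> A2.
Proof. by apply/ffunP => -[x y]; rewrite [LHS]ffunE -[RHS]/(gel k 1%g (x, y)) gelE -xpair_eqE. Qed.

Lemma DeltaJE (J Ji : kG2 k gT) (a : kG k gT) :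
  DeltaJ J Ji a = (Ji : A2) * (cop a * J).
Proof. by rewrite /DeltaJ -copE. Qed.

Definition counit : A -> k^o := lext (fun=> 1 : k^o).
HB.instance Definition _ := GRing.Linear.on counit.

Lemma counit_gel g : counit (gel k g) = 1. Proof. exact: lext_gel. Qed.
Lemma counitE a : counit a = eps a.
Proof. by apply: eq_bigr => g _; rewrite /GRing.scale /= mulr1. Qed.

Lemma counitM a b : counit (a * b) = counit a * counit b.
Proof.
rewrite [a]galg_expand [b]galg_expand.
rewrite mulr_suml !linear_sum mulr_suml; apply: eq_bigr => g _.
rewrite mulr_sumr !linear_sum mulr_sumr; apply: eq_bigr => h _.
rewrite -scalerAl -scalerAr !linearZ /= -gelM !counit_gel /=.
by rewrite /GRing.scale /= !mulr1.
Qed.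

Lemma counit1 : counit 1 = 1. Proof. exact: counit_gel. Qed.

(* [slice f] is [id (x) f], where the function [f] is extended linearly *)
Definition slice (f : gT -> k^o) : A2 -> A := 
  lext (fun x : gT * gT => (f x.2 : k) *: gel k x.1).
HB.instance Definition _ f := GRing.Linear.on (slice f).

Lemma slice_tens f a b : slice f (tens a b) = (lext f b : k) *: a.
Proof.
rewrite /slice lext_tens; under eq_fun => g.
  rewrite (_ : lext _ b = (lext f b : k) *: gel k g); last first.
    by rewrite {2}/lext scaler_suml; apply: eq_bigr => h _; rewrite scalerA.
  over.
rewrite [in RHS](galg_expand a) scaler_sumr; apply: eq_bigr => g _.
by rewrite !scalerA mulrC.
Qed.

Definition swap (x : gT * gT) := (x.2, x.1).
Lemma swapM : {morph swap : x y / (x * y)%g}. Proof. by []. Qed.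

Lemma pushf_swap_tens a b : pushf swap (tens a b) = tens b a.
Proof.
apply/ffunP => -[x y]; rewrite tensE -[(x, y)]/(swap (y, x)).
by rewrite pushf_inj ?tensE 1?mulrC // => -[? ?] [? ?] [-> ->].
Qed.

End Coproduct.
End TensorSquare.

(** * Idempotents of characters and diagonal twists *)

Section CharacterIdempotents.
Variables (k : fieldType) (k_char0 : [pchar k] =i pred0).
Variables (gT : finGroupType) (H : {group gT}).
Variables (X : finGroupType) (chi : X -> gT -> k).
Hypothesis chi_dual : dual_group_param H chi.
Local Notation A := (galg k gT).
Local Notation A2 := (galg k (gT * gT)%type).

Lemma chiMx x : {in H &, forall g h, chi x (g * h)%g = chi x g * chi x h}.
Proof. by case: chi_dual => + _ _ _ => /(_ x) []. Qed.

Lemma chi_neq0 x : {in H, forall h, chi x h != 0}.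
Proof. by case: chi_dual => + _ _ _ => /(_ x) []. Qed.

Lemma chiM x y : {in H, forall h, chi (x * y)%g h = chi x h * chi y h}.
Proof. by case: chi_dual => _ + _ _ => /(_ x y). Qed.

Lemma chi_inj x y : {in H, forall h, chi x h = chi y h} -> x = y.
Proof. by case: chi_dual => _ _ + _ => /(_ x y). Qed.

Lemma chix1 x : chi x 1%g = 1.
Proof.
apply: (mulfI (chi_neq0 x (group1 H))).
by rewrite mulr1 -chiMx ?group1 ?mulg1.
Qed.

Lemma chixV x : {in H, forall h, chi x h^-1%g = (chi x h)^-1}.
Proof.
move=> h hH; apply: (mulfI (chi_neq0 x hH)).
by rewrite divff ?chi_neq0 // -chiMx ?groupV // mulgV chix1.
Qed.

Lemma chi1 : {in H, forall h, chi 1%g h = 1}.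
Proof.
move=> h hH; apply: (mulfI (chi_neq0 1%g hH)).
by rewrite mulr1 -chiM ?mulg1.
Qed.

Lemma chiV x : {in H, forall h, chi x^-1%g h = (chi x h)^-1}.
Proof.
move=> h hH; apply: (mulfI (chi_neq0 x hH)).
by rewrite divff ?chi_neq0 // -chiM // mulgV chi1.
Qed.

Lemma abelian_dual (x y : X) : (x * y)%g = (y * x)%g.
Proof. by apply: chi_inj => h hH; rewrite !chiM // mulrC. Qed.

Lemma natH_neq0 (K : {group gT}) : #|K|%:R != 0 :> k.
Proof. by rewrite ((pcharf0P k).1 k_char0) -lt0n cardG_gt0. Qed.

Lemma chi_sum0 (K : {group gT}) x h0 : K \subset H -> h0 \in K -> chi x h0 != 1 ->
  \sum_(h in K) chi x h = 0.
Proof.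
move=> KH h0K; apply: contraNeq => S0; apply/eqP/(mulIf S0); rewrite mul1r mulr_sumr.
rewrite [RHS](reindex_inj (mulgI h0)) /=; apply: eq_big => h; first by rewrite groupMl.
by move=> hK; rewrite chiMx ?(subsetP KH).
Qed.

Lemma chi_sum x : \sum_(h in H) chi x h = if x == 1%g then #|H|%:R else 0.
Proof.
case: eqP => [->|x1]; first by rewrite (eq_bigr (fun=> 1)) ?sumr_const // => h /chi1.
case: (boolP [forall h in H, chi x h == 1]) => [/forall_inP x1H|].
  by case: x1; apply: chi_inj => h hH; rewrite chi1 // (eqP (x1H _ hH)).
by rewrite negb_forall_in => /exists_inP [h0 h0H]; apply: chi_sum0.
Qed.

Definition ee x : A := e_idem H (chi x).

Lemma eeE x : ee x = #|H|%:R^-1 *: \sum_(h in H) chi x h^-1%g *: gel k h.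
Proof.
apply/ffunP => g; rewrite ffunE galgZE galg_sumE.
case: ifP => gH.
  rewrite (bigD1 g) //= big1 ?addr0 ?galgZE ?gelE ?eqxx ?mulr1 // => h /andP[_ hg].
  by rewrite galgZE gelE eq_sym (negbTE hg) mulr0.
rewrite big1 ?mulr0 // => h hH; rewrite galgZE gelE; case: eqP => [gh|]; last by rewrite mulr0.
by rewrite gh hH in gH.
Qed.

Lemma gel_ee x : {in H, forall h, gel k h * ee x = chi x h *: ee x}.
Proof.
move=> h hH; rewrite eeE -scalerAr scalerA mulrC -scalerA; congr (_ *: _).
rewrite mulr_sumr scaler_sumr (reindex_inj (mulgI h^-1%g)) /=.
apply: eq_big => g; first by rewrite groupMl ?groupV.
rewrite groupMl ?groupV // => gH.
by rewrite -scalerAr -gelM mulKVg invMg invgK chiMx ?groupV // scalerA mulrC.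
Qed.

Lemma orthogonality x y :
  #|H|%:R^-1 * (\sum_(h in H) chi x h^-1%g * chi y h) = (x == y)%:R.
Proof.
rewrite (eq_bigr (chi (x^-1 * y)%g)); last first.
  by move=> h hH; rewrite chiM // chiV // chixV.
rewrite chi_sum -eq_mulVg1; case: eqP => _; last by rewrite mulr0.
by rewrite mulVf ?natH_neq0.
Qed.

(** [ee x] averages group elements against the inverse of [chi x], so on a [y]-eigenvector
    orthogonality leaves a Kronecker delta. A general [F] lets the same computation serve products,
    the counit and the coproduct. *)
Lemma ee_eigen (B : lalgType k) (F : {linear A -> B}) (b : B) x y :
  {in H, forall h, F (gel k h) * b = chi y h *: b} -> F (ee x) * b = (x == y)%:R *: b.
Proof.
move=> Fb; rewrite eeE linearZ linear_sum /= -scalerAl mulr_suml.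
rewrite (eq_bigr (fun h => (chi x h^-1%g * chi y h) *: b)); last first.
  by move=> h hH; rewrite linearZ -scalerAl Fb // scalerA.
by rewrite -scaler_suml scalerA orthogonality.
Qed.

Lemma ee_orth x y : ee x * ee y = (x == y)%:R *: ee y.
Proof. by apply: (ee_eigen (F := idfun)) => h hH; rewrite gel_ee. Qed.

Lemma counit_ee x : counit (ee x) = (x == 1%g)%:R.
Proof.
rewrite -[LHS]mulr1 (@ee_eigen k^o (@counit k gT) 1 x 1%g) ?counit_gel //.
  by rewrite /GRing.scale /= mulr1.
by move=> h hH; rewrite /= counit_gel chi1 // scale1r mulr1.
Qed.

(** The coproduct of [h] acts on a tensor product of eigenvectors by the product of the two
    characters. *)
Lemma cop_ee z x y : cop (ee z) * tens (ee x) (ee y) = (z == (x * y)%g)%:R *: tens (ee x) (ee y).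
Proof.
apply: (ee_eigen (F := @cop k gT)) => h hH.
by rewrite /= cop_gel -tens_gel tensM !gel_ee // tensZl tensZr scalerA chiM.
Qed.

Definition antip : A -> A := pushf (fun g => g^-1%g).
HB.instance Definition _ := GRing.Linear.on antip.

Lemma antip_gel g : antip (gel k g) = gel k g^-1%g.
Proof. exact: pushf_gel. Qed.

Lemma antip_ee x : antip (ee x) = ee x^-1%g.
Proof.
rewrite !eeE linearZ linear_sum /=; congr (_ *: _); rewrite (reindex_inj invg_inj) /=.
apply: eq_big => g; rewrite ?groupV // => gH.
by rewrite linearZ /= antip_gel invgK chiV ?groupV // chixV // invrK.
Qed.

Definition dtens x y : A2 := tens (ee x) (ee y).

(** With [w] an arbitrary function, the twist, its inverse and its flip are all instances, and their
    products are computed pointwise. *)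
Definition Jw (w : X -> X -> k) : A2 := \sum_x \sum_y w x y *: dtens x y.

Lemma twistJE w : twistJ H chi w = Jw w.
Proof.
apply/ffunP => -[g h]; rewrite ffunE /Jw galg_sumE; apply: eq_bigr => x _.
by rewrite galg_sumE; apply: eq_bigr => y _; rewrite galgZE tensE mulrA.
Qed.

Lemma Jw_dtens w x y : Jw w * dtens x y = w x y *: dtens x y.
Proof.
rewrite /Jw mulr_suml (bigD1 x) //= [X in _ + X]big1 ?addr0 => [|x' /negbTE xx'].
  rewrite mulr_suml (bigD1 y) //= [X in _ + X]big1 ?addr0 => [|y' /negbTE yy'].
    by rewrite -scalerAl tensM !ee_orth !eqxx !scale1r.
  by rewrite -scalerAl tensM !ee_orth yy' tensZr scale0r scaler0.
rewrite mulr_suml big1 // => y' _.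
by rewrite -scalerAl tensM !ee_orth xx' tensZl scale0r scaler0.
Qed.

(** Completeness of the idempotents, that is, existence of enough characters; [twist_inv_sum_ee]
    deduces it from the invertibility of the twist. *)
Hypothesis sum_ee : \sum_x ee x = 1.

Lemma sum_dtens : \sum_x \sum_y dtens x y = 1.
Proof.
rewrite -tens1 -sum_ee tens_suml; apply: eq_bigr => x _.
by rewrite tens_sumr.
Qed.

Lemma dtens_ext (T T' : A2) : (forall x y, T * dtens x y = T' * dtens x y) -> T = T'.
Proof.
move=> TT; rewrite -[T]mulr1 -[T']mulr1 -sum_dtens !mulr_sumr; apply: eq_bigr => x _.
by rewrite !mulr_sumr; apply: eq_bigr => y _.
Qed.

Lemma gel_sum_ee h : h \in H -> gel k h = \sum_x chi x h *: ee x.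
Proof.
move=> hH; rewrite -[LHS]mulr1 -sum_ee mulr_sumr.
by apply: eq_bigr => x _; rewrite gel_ee.
Qed.

Lemma Jw_mul w w' : Jw w * Jw w' = Jw (fun x y => w x y * w' x y).
Proof.
rewrite {2 3}/Jw mulr_sumr; apply: eq_bigr => x _; rewrite mulr_sumr.
by apply: eq_bigr => y _; rewrite -scalerAr Jw_dtens scalerA mulrC.
Qed.

Lemma Jw_const c : Jw (fun _ _ => c) = c%:A.
Proof.
rewrite /Jw -sum_dtens scaler_sumr; apply: eq_bigr => x _.
by rewrite scaler_sumr.
Qed.

Lemma Jw_inv w : (forall x y, w x y != 0) ->
  Jw w * Jw (fun x y => (w x y)^-1) = 1 /\ Jw (fun x y => (w x y)^-1) * Jw w = 1.
Proof.
move=> w0; rewrite !Jw_mul -(scale1r 1) -Jw_const; split;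
  by apply: eq_bigr => x _; apply: eq_bigr => y _; rewrite ?mulVf ?divff.
Qed.

End CharacterIdempotents.

(** * Coassociativity of the twisted coproduct *)

Section BilinearExtension.
Variables (k : fieldType) (gT hT : finGroupType) (V : lmodType k).

(** The universal property of the tensor product, in the form used to identify linear maps given on
    pairs of group elements. *)
Lemma tens_ext (F : {linear galg k (gT * hT)%type -> V}) (B : galg k gT -> galg k hT -> V) :
  (forall b, linear (B^~ b)) -> (forall a, linear (B a)) ->
  (forall g h, F (gel k (g, h)) = B (gel k g) (gel k h)) ->
  forall a b, F (tens a b) = B a b.
Proof.
move=> Bl Br FB a b.
pose Bl' b : {linear galg k gT -> V} := HB.pack (B^~ b) (GRing.isLinear.Build k _ _ _ (B^~ b) (Bl b)).
pose Br' a : {linear galg k hT -> V} := HB.pack (B a) (GRing.isLinear.Build k _ _ _ (B a) (Br a)).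
rewrite [a]galg_expand -[RHS]/(Bl' b _) tens_suml !linear_sum; apply: eq_bigr => g _.
rewrite tensZl !linearZ; congr (_ *: _) => /=.
rewrite [b]galg_expand -[RHS]/(Br' (gel k g) _) tens_sumr !linear_sum; apply: eq_bigr => h _.
by rewrite tensZr !linearZ tens_gel FB.
Qed.

Lemma lext_pushf (phi : gT -> hT) (f : hT -> V) a : lext f (pushf phi a) = lext (f \o phi) a.
Proof.
apply: (linear_gel_eq (F := lext f \o pushf phi) (F' := lext (f \o phi))) a => g /=.
by rewrite pushf_gel !lext_gel.
Qed.

End BilinearExtension.

Section TripleTensor.
Variables (k : fieldType) (gT : finGroupType).
Local Notation A := (galg k gT).
Local Notation A2 := (galg k (gT * gT)%type).
Local Notation A3 := (galg k (gT * gT * gT)%type).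

Definition assoc3 (x : gT * (gT * gT)) : gT * gT * gT := (x.1, x.2.1, x.2.2).

Definition copL : A2 -> A3 := pushf (fun x : gT * gT => (x.1, x.1, x.2)).
HB.instance Definition _ := GRing.Linear.on copL.
Definition copR : A2 -> A3 := pushf (fun x : gT * gT => (x.1, x.2, x.2)).
HB.instance Definition _ := GRing.Linear.on copR.
Definition inj12 (T : A2) : A3 := tens T 1.
Definition inj23 (T : A2) : A3 := pushf assoc3 (tens 1 T).

Lemma copLM : {morph copL : a b / a * b}. Proof. exact: pushfM. Qed.
Lemma copRM : {morph copR : a b / a * b}. Proof. exact: pushfM. Qed.
Lemma assoc3M : {morph pushf assoc3 : a b / (a : galg k _) * b}. Proof. exact: pushfM. Qed.
Lemma inj12M : {morph inj12 : a b / a * b}.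
Proof. by move=> a b; rewrite /inj12 tensM mulr1. Qed.
Lemma inj23M : {morph inj23 : a b / a * b}.
Proof. by move=> a b; rewrite /inj23 -assoc3M tensM mulr1. Qed.

Lemma copL_tens (a b : A) : copL (tens a b) = tens (cop a) b.
Proof.
apply: (tens_ext (F := copL) (B := fun a b => tens (cop a) b)) => {a b}.
- by move=> b c a a'; rewrite linearP tens_linear_l.
- by move=> a; apply: tens_linear_r.
by move=> g h; rewrite cop_gel tens_gel; exact: pushf_gel.
Qed.

Lemma copR_tens (a b : A) : copR (tens a b) = pushf assoc3 (tens a (cop b)).
Proof.
apply: (tens_ext (F := copR) (B := fun a b => pushf assoc3 (tens a (cop b)))) => {a b}.
- by move=> b c a a'; rewrite tens_linear_l linearP.
- by move=> a c b b'; rewrite !linearP.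
by move=> g h; rewrite cop_gel tens_gel pushf_gel; exact: pushf_gel.
Qed.

Lemma assoc3_tens (a b c : A) : pushf assoc3 (tens a (tens b c)) = tens (tens a b) c.
Proof.
apply/ffunP => -[[x y] z]; rewrite -[(x, y, z)]/(assoc3 (x, (y, z))).
by rewrite pushf_inj ?tensE /= ?mulrA // => -[? [? ?]] [? [? ?]] [-> -> ->].
Qed.

Section Coassociativity.
Variables J Ji : A2.
Hypotheses (JK : J * Ji = 1) (JiK : Ji * J = 1).
(** The twist equation, in the convention where the coproduct is conjugated as
    [Ji * (cop a * J)]. *)
Hypothesis Jcoc : copL J * inj12 J = copR J * inj23 J.

Definition DJ (a : A) : A2 := Ji * (cop a * J).

Lemma DJ_linear : linear DJ.
Proof.
by move=> c a b; rewrite /DJ linearP mulrDl mulrDr -scalerAl -scalerAr.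
Qed.
HB.instance Definition _ := GRing.isLinear.Build k _ _ _ DJ DJ_linear.

Lemma DJM a b : DJ (a * b) = DJ a * DJ b.
Proof. by rewrite /DJ copM -!mulrA (mulrA J Ji) JK mul1r. Qed.

Lemma cop_DJ a : cop a * J = J * DJ a.
Proof. by rewrite /DJ mulrA JK mul1r. Qed.

Let W := copL J * inj12 J.
Let Winv : (inj12 Ji * copL Ji) * W = 1.
Proof.
rewrite /W -mulrA (mulrA (copL Ji)) -copLM JiK.
rewrite (_ : copL 1 = 1) ?mul1r -?inj12M ?JiK; first exact: tens1.
exact: pushf1.
Qed.
Let WinvR : W * (inj23 Ji * copR Ji) = 1.
Proof.
rewrite /W Jcoc -mulrA (mulrA (inj23 J)) -inj23M JK.
rewrite (_ : inj23 1 = 1) ?mul1r -?copRM ?JK; first exact: pushf1.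
by rewrite /inj23 tens1 pushf1.
Qed.

Lemma tens_DJl c d : tens (DJ c) d = inj12 Ji * (copL (tens c d) * inj12 J).
Proof. by rewrite copL_tens /inj12 !tensM mulr1 mul1r. Qed.

Lemma tens_DJr c d : pushf assoc3 (tens c (DJ d)) = inj23 Ji * (copR (tens c d) * inj23 J).
Proof. by rewrite copR_tens /inj23 -!assoc3M !tensM mulr1 mul1r. Qed.

(** Both sides are the twice iterated coproduct of [a] conjugated by [W], the common value of the
    two sides of the twist equation. *)
Lemma coassoc a :
  inj12 Ji * (copL (DJ a) * inj12 J) = inj23 Ji * (copR (DJ a) * inj23 J).
Proof.
rewrite /DJ !copLM !copRM.
have -> : copL (cop a) = copR (cop a).
  by rewrite /copL /copR /cop !pushf_comp.
have eqW : inj12 Ji * copL Ji = inj23 Ji * copR Ji.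
  by rewrite -[LHS]mulr1 -WinvR mulrA Winv mul1r.
by rewrite !mulrA eqW -!mulrA Jcoc.
Qed.

(** Coassociativity in Sweedler form, for an arbitrary trilinear expression in the three legs. *)
Lemma coassoc_lext (V : lmodType k) (f : gT -> gT -> gT -> V) a :
  lext (fun x : gT * gT => lext (fun y : gT * gT => f y.1 y.2 x.2) (DJ (gel k x.1))) (DJ a) =
  lext (fun x : gT * gT => lext (fun y : gT * gT => f x.1 y.1 y.2) (DJ (gel k x.2))) (DJ a).
Proof.
pose F : {linear A3 -> V} := lext (fun x : gT * gT * gT => f x.1.1 x.1.2 x.2).
have expand (L : {linear A2 -> A3}) u v T :
    F (u * (L T * v)) = \sum_(x : gT * gT) T x *: F (u * (L (gel k x) * v)).
  rewrite {1}[T]galg_expand (linear_sum L) mulr_suml mulr_sumr (linear_sum F).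
  apply: eq_bigr => x _.
  by rewrite (linearZ_LR L) /= -scalerAl -scalerAr (linearZ_LR F).
have expL T : F (inj12 Ji * (copL T * inj12 J)) =
    \sum_(x : gT * gT) T x *: F (tens (DJ (gel k x.1)) (gel k x.2)).
  by rewrite (expand copL); apply: eq_bigr => -[g h] _; rewrite tens_DJl tens_gel.
have expR T : F (inj23 Ji * (copR T * inj23 J)) =
    \sum_(x : gT * gT) T x *: F (pushf assoc3 (tens (gel k x.1) (DJ (gel k x.2)))).
  by rewrite (expand copR); apply: eq_bigr => -[g h] _; rewrite tens_DJr tens_gel.
have /(congr1 F) := coassoc a; rewrite expL expR => eqF.
rewrite {1}/lext (eq_bigr (fun x : gT * gT => DJ a x *: F (tens (DJ (gel k x.1)) (gel k x.2)))).
  rewrite eqF; apply: eq_bigr => x _; congr (_ *: _).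
  by rewrite /F /= lext_pushf lext_tens lext_gel; apply: eq_bigr => y _.
move=> x _; congr (_ *: _); rewrite /F /= lext_tens; apply: eq_bigr => y _.
by rewrite lext_gel.
Qed.

End Coassociativity.
End TripleTensor.

(** * Two-cocycles and their alternating bicharacter *)

Section Cocycles.
Variables (k : fieldType) (X : finGroupType) (w : X -> X -> k).
Hypothesis w_coc : is_2cocycle w.

Let w0 x y : w x y != 0. Proof. by case: w_coc. Qed.
Let wc x y z : w x y * w (x * y)%g z = w y z * w x (y * z)%g. Proof. by case: w_coc. Qed.

(** The cocycle is not assumed normalized: [w 1 1] stands where a normalized cocycle has the value
    1. *)
Lemma cocycle_x1 x : w x 1%g = w 1%g 1%g.
Proof. by apply: (mulIf (w0 x 1%g)); have := wc x 1%g 1%g; rewrite !mulg1. Qed.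

Lemma cocycle_1x x : w 1%g x = w 1%g 1%g.
Proof. by apply: (mulIf (w0 1%g x)); have := wc 1%g 1%g x; rewrite !mul1g => ->. Qed.

Lemma cocycle_xV x : w x x^-1%g = w x^-1%g x.
Proof.
apply: (mulIf (w0 1%g x)); have := wc x x^-1%g x.
by rewrite mulgV mulVg cocycle_x1 cocycle_1x.
Qed.

Definition alt (x y : X) := w x y / w y x.

Lemma altxx x : alt x x = 1. Proof. by rewrite /alt divff. Qed.

Lemma altC x y : alt x y = (alt y x)^-1.
Proof. by rewrite /alt invfM invrK mulrC. Qed.

Hypothesis X_ab : forall x y : X, (x * y)%g = (y * x)%g.

(** Three instances of the cocycle identity express the values at products; by commutativity the
    remaining factors cancel. *)
Lemma altM x y z : alt (x * y)%g z = alt x z * alt y z.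
Proof.
have h1 := wc x y z; have h2 := wc z x y; have h3 := wc x z y.
rewrite /alt (X_ab z x) in h2 *; rewrite (X_ab z y) in h3.
have -> : w (x * y)%g z = w y z * w x (y * z)%g / w x y.
  by rewrite -h1 mulrC mulKf.
have -> : w z (x * y)%g = w z x * w (x * z)%g y / w x y.
  by rewrite h2 mulrC mulKf.
have -> : w (x * z)%g y = w z y * w x (y * z)%g / w x z.
  by rewrite -h3 mulrC mulKf.
by field; rewrite !w0.
Qed.

End Cocycles.

(** * From cocycles on the dual group to twists *)

Section Twist.
Variables (k : fieldType) (k_char0 : [pchar k] =i pred0).
Variables (gT : finGroupType) (H : {group gT}).
Variables (X : finGroupType) (chi : X -> gT -> k).
Hypothesis chi_dual : dual_group_param H chi.
Local Notation A := (galg k gT).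
Local Notation A2 := (galg k (gT * gT)%type).
Local Notation A3 := (galg k (gT * gT * gT)%type).
Local Notation ee := (ee H chi).
Local Notation dtens := (dtens H chi).
Local Notation Jw := (Jw H chi).
Hypothesis sum_ee : \sum_x ee x = 1.

Lemma Jw_eigen (B : lalgType k) (F : {linear A2 -> B}) (b : B) x y (w : X -> X -> k) :
  (forall u v, F (dtens u v) * b = ((u == x) && (v == y))%:R *: b) ->
  F (Jw w) * b = w x y *: b.
Proof.
move=> Fb; rewrite (linear_sum F) mulr_suml (bigD1 x) //= [X in _ + X]big1 ?addr0; last first.
  move=> u /negbTE ux; rewrite (linear_sum F) mulr_suml big1 // => v _.
  by rewrite (linearZ_LR F) -scalerAl Fb ux scale0r scaler0.
rewrite (linear_sum F) mulr_suml (bigD1 y) //= [X in _ + X]big1 ?addr0; last first.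
  move=> v /negbTE vy; rewrite (linearZ_LR F) -scalerAl Fb vy andbF scale0r scaler0.
  by [].
by rewrite (linearZ_LR F) -scalerAl Fb !eqxx scale1r.
Qed.

(** On the common eigenvectors [d3 x y z] both sides act by scalars, and the twist equation becomes
    the cocycle identity. *)
Lemma Jw_cocycle w : is_2cocycle w ->
  copL (Jw w) * inj12 (Jw w) = copR (Jw w) * inj23 (Jw w).
Proof.
case=> w0 wc; pose d3 x y z : A3 := tens (dtens x y) (ee z).
have sum3 : \sum_x \sum_y \sum_z d3 x y z = 1.
  rewrite -tens1 -(sum_dtens sum_ee) tens_suml; apply: eq_bigr => x _.
  rewrite tens_suml; apply: eq_bigr => y _.
  by rewrite -sum_ee tens_sumr.
have on3 (T T' : A3) : (forall x y z, T * d3 x y z = T' * d3 x y z) -> T = T'.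
  move=> TT; rewrite -[T]mulr1 -[T']mulr1 -sum3 !mulr_sumr; apply: eq_bigr => x _.
  rewrite !mulr_sumr; apply: eq_bigr => y _.
  by rewrite !mulr_sumr; apply: eq_bigr => z _.
apply: on3 => x y z.
have -> : copL (Jw w) * inj12 (Jw w) * d3 x y z = (w x y * w (x * y)%g z) *: d3 x y z.
  rewrite -mulrA /inj12 tensM (Jw_dtens k_char0 chi_dual) mul1r tensZl -scalerAr.
  rewrite (@Jw_eigen _ (@copL k gT) _ (x * y)%g z) ?scalerA // => u v.
  rewrite /= copL_tens tensM (cop_ee k_char0 chi_dual) (ee_orth k_char0 chi_dual).
  by rewrite tensZl tensZr scalerA -natrM mulnb andbC andbC.
have -> : copR (Jw w) * inj23 (Jw w) * d3 x y z = (w y z * w x (y * z)%g) *: d3 x y z.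
  rewrite -mulrA /d3 -assoc3_tens /inj23 -assoc3M tensM mul1r.
  rewrite (Jw_dtens k_char0 chi_dual) tensZr (linearZ_LR (@pushf _ _ _ _)) -scalerAr.
  rewrite (@Jw_eigen _ (@copR k gT) _ x (y * z)%g) ?scalerA // => u v.
  rewrite /= copR_tens -assoc3M tensM (cop_ee k_char0 chi_dual).
  rewrite (ee_orth k_char0 chi_dual) tensZl tensZr scalerA -natrM mulnb.
  by rewrite (linearZ_LR (@pushf _ _ _ _)).
by rewrite wc.
Qed.
End Twist.

(** * Counit and antipode of the twisted Hopf algebra *)

Section TwistedCoproduct.
Variables (k : fieldType) (k_char0 : [pchar k] =i pred0).
Variables (gT : finGroupType) (H : {group gT}).
Variables (X : finGroupType) (chi : X -> gT -> k).
Hypothesis chi_dual : dual_group_param H chi.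
Local Notation A := (galg k gT).
Local Notation A2 := (galg k (gT * gT)%type).
Local Notation ee := (ee H chi).
Local Notation dtens := (dtens H chi).
Local Notation Jw := (Jw H chi).
Hypothesis sum_ee : \sum_x ee x = 1.

(** The element of [kH] whose Fourier transform is [c]. *)
Definition diag_ee (c : X -> k) : A := \sum_x c x *: ee x.

Lemma diag_ee_r c x : diag_ee c * ee x = c x *: ee x.
Proof.
rewrite mulr_suml (bigD1 x) //= big1 ?addr0 => [|y /negbTE yx];
  by rewrite -scalerAl (ee_orth k_char0 chi_dual) ?eqxx ?scale1r ?yx ?scale0r ?scaler0.
Qed.

Lemma diag_ee_l c x : ee x * diag_ee c = c x *: ee x.
Proof.
rewrite mulr_sumr (bigD1 x) //= big1 ?addr0 => [|y yx].
  by rewrite -scalerAr (ee_orth k_char0 chi_dual) ?eqxx ?scale1r.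
by rewrite -scalerAr (ee_orth k_char0 chi_dual) eq_sym (negbTE yx) scale0r scaler0.
Qed.

Lemma diag_eeM c d : diag_ee c * diag_ee d = diag_ee (fun x => c x * d x).
Proof.
rewrite {2}/diag_ee mulr_sumr; apply: eq_bigr => x _.
by rewrite -scalerAr diag_ee_r scalerA mulrC.
Qed.

Lemma diag_ee_const c : diag_ee (fun=> c) = c%:A.
Proof. by rewrite /diag_ee -scaler_sumr sum_ee. Qed.

Lemma eq_diag_ee c d : c =1 d -> diag_ee c = diag_ee d.
Proof. by move=> cd; apply: eq_bigr => x _; rewrite cd. Qed.

Lemma diag_ee_unit c d : (forall x, c x * d x = 1) -> diag_ee c * diag_ee d = 1.
Proof. by move=> cd; rewrite diag_eeM (eq_diag_ee cd) diag_ee_const scale1r. Qed.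

(** The map applying the counit to the second leg, obtained by forgetting the second group
    component. *)
Definition counR : A2 -> A := pushf (fun x : gT * gT => x.1).
HB.instance Definition _ := GRing.Linear.on counR.

Lemma counRM : {morph counR : a b / a * b}. Proof. exact: pushfM. Qed.

Lemma counR_tens a b : counR (tens a b) = (counit b : k) *: a.
Proof.
apply: (tens_ext (F := counR) (B := fun a b => (counit b : k) *: a)) => {a b}.
- by move=> b c a a'; rewrite scalerDr !scalerA mulrC.
- by move=> a c b b'; rewrite linearP scalerDl -scalerA.
by move=> g h; rewrite counit_gel scale1r; exact: pushf_gel.
Qed.

Lemma counR_Jw w : (forall x, w x 1%g = w 1%g 1%g) -> counR (Jw w) = (w 1%g 1%g)%:A.
Proof.
move=> w1; rewrite -diag_ee_const (linear_sum counR); apply: eq_bigr => x _.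
rewrite (linear_sum counR) (bigD1 1%g) //= big1 ?addr0 => [|y /negbTE y1];
  rewrite (linearZ_LR counR) /= counR_tens (counit_ee k_char0 chi_dual).
  by rewrite eqxx scale1r w1.
by rewrite y1 scale0r scaler0.
Qed.

(** Applying the counit to one leg turns the twist into the scalar [w 1 1], which its inverse
    cancels. *)
Lemma counR_DJ w Ji a : Ji * Jw w = 1 -> (forall x, w x 1%g = w 1%g 1%g) ->
  counR (DJ (Jw w) Ji a) = a.
Proof.
move=> JiK w1; rewrite /DJ !counRM (_ : counR (cop a) = a); last first.
  by rewrite /counR /cop pushf_comp [RHS]galg_expand.
rewrite counR_Jw // -scalerAr mulr1 -[in LHS](mul1r a) scalerAl.
by rewrite -(counR_Jw w1) mulrA -counRM JiK; rewrite (_ : counR 1 = 1) ?mul1r //; exact: pushf1.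
Qed.

Lemma antip_anti a b : antip (a * b) = antip b * antip a :> A.
Proof.
rewrite [a]galg_expand mulr_suml !(linear_sum (@antip k gT)) mulr_sumr.
apply: eq_bigr => g _; rewrite -scalerAl !(linearZ_LR (@antip k gT)) -scalerAr /=.
congr (_ *: _); rewrite [b]galg_expand mulr_sumr !(linear_sum (@antip k gT)) mulr_suml.
apply: eq_bigr => h _; rewrite -scalerAr !(linearZ_LR (@antip k gT)) -scalerAl /=.
by rewrite -gelM !antip_gel invMg gelM.
Qed.

(* The antipode of the twisted Hopf algebra is [S] conjugated by
   [m (S (x) id) J], which is [diag_ee (fun x => w x^-1 x)]. *)
Definition antipJ (w : X -> X -> k) (a : A) : A :=
  diag_ee (fun x => (w x^-1%g x)^-1) * antip a * diag_ee (fun x => w x^-1%g x).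

Lemma antipJ_linear w : linear (antipJ w).
Proof.
by move=> c a b; rewrite /antipJ linearP mulrDr mulrDl -scalerAr -scalerAl.
Qed.
HB.instance Definition _ w := GRing.isLinear.Build k _ _ _ (antipJ w) (antipJ_linear w).

Lemma antipJ_l w a : (forall x y, w x y != 0) ->
  lext (fun x : gT * gT => antipJ w (gel k x.1) * gel k x.2)
       (DJ (Jw w) (Jw (fun x y => (w x y)^-1)) a) = (counit a : k) *: 1.
Proof.
move=> w0; set w' := fun x y => (w x y)^-1; set U' := diag_ee (fun x => (w x^-1%g x)^-1).
pose M : {linear A2 -> A} := lext (fun x : gT * gT => antipJ w (gel k x.1) * gel k x.2).
pose M2 : {linear A2 -> A} := lext (fun x : gT * gT => U' * antip (gel k x.1) * gel k x.2).
have ME a1 b1 : M (tens a1 b1) = antipJ w a1 * b1.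
  apply: (tens_ext (B := fun a b => antipJ w a * b)) => {a1 b1}.
  - by move=> b c a1 a2; rewrite linearP mulrDl -scalerAl.
  - by move=> a1 c b b'; rewrite mulrDr -scalerAr.
  by move=> g h; rewrite /M /= lext_gel.
have M2E a1 b1 : M2 (tens a1 b1) = U' * antip a1 * b1.
  apply: (tens_ext (B := fun a b => U' * antip a * b)) => {a1 b1}.
  - by move=> b c a1 a2; rewrite linearP mulrDr mulrDl -scalerAr -scalerAl.
  - by move=> a1 c b b'; rewrite mulrDr -scalerAr.
  by move=> g h; rewrite /M2 /= lext_gel.
(* The antipode sends [ee x^-1] to [ee x], so only the pairs [x^-1, x] survive; the right-hand
   factor of [antipJ] cancels the coefficients of the inverse twist there. *)
have MJ T : M (Jw w' * T) = M2 T.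
  rewrite [T]galg_expand mulr_sumr !linear_sum; apply: eq_bigr => -[g h] _.
  rewrite -scalerAr !linearZ_LR; congr (_ *: _); rewrite -tens_gel M2E.
  rewrite /Jw mulr_suml (linear_sum M) (reindex_inj invg_inj) /=.
  rewrite -[U' * _]mulr1 -sum_ee mulr_sumr mulr_suml; apply: eq_bigr => x _.
  rewrite mulr_suml (linear_sum M) (bigD1 x) //= big1 ?addr0 => [|y /negbTE yx];
    rewrite -scalerAl (linearZ_LR M) tensM ME /antipJ antip_anti (antip_ee chi_dual) invgK;
    rewrite -!mulrA (mulrA (ee x)) diag_ee_l -scalerAl (mulrA (ee x)) (ee_orth k_char0 chi_dual).
    by rewrite eqxx scale1r /= -!scalerAr scalerA /w' mulVf ?scale1r // !mulrA.
  by rewrite eq_sym yx scale0r !(mul0r, mulr0, scaler0).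
(* The coefficients of [J] at the pairs [x^-1, x] assemble into the inverse of [U'], the remaining
   factor. *)
have M2J g : M2 (gel k (g, g) * Jw w) = 1.
  rewrite -[RHS](@diag_ee_unit (fun x => (w x^-1%g x)^-1) (fun x => w x^-1%g x)); last first.
    by move=> x; rewrite mulVf.
  rewrite {2}/diag_ee mulr_sumr /Jw mulr_sumr (linear_sum M2) (reindex_inj invg_inj) /=.
  apply: eq_bigr => x _; rewrite mulr_sumr (linear_sum M2).
  rewrite (bigD1 x) //= big1 ?addr0 => [|y /negbTE yx];
    rewrite -scalerAr (linearZ_LR M2) -tens_gel tensM M2E antip_anti (antip_ee chi_dual) invgK antip_gel;
    rewrite -!mulrA (mulrA (gel k g^-1%g)) -gelM mulVg gel1 mul1r (ee_orth k_char0 chi_dual).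
    by rewrite eqxx scale1r scalerAr.
  by rewrite eq_sym yx scale0r !(mulr0, scaler0).
rewrite -[LHS]/(M _) /DJ MJ [a]galg_expand !linear_sum mulr_suml linear_sum scaler_suml.
apply: eq_bigr => g _.
by rewrite !linearZ_LR -scalerAl linearZ_LR /= cop_gel M2J counit_gel /GRing.scale /= mulr1.
Qed.
End TwistedCoproduct.

(** * Slices by equivariant functions and characters of subgroups *)

Section Slices.
Variables (k : fieldType) (k_char0 : [pchar k] =i pred0).
Variables (gT : finGroupType) (H : {group gT}).
Variables (X : finGroupType) (chi : X -> gT -> k).
Hypothesis chi_dual : dual_group_param H chi.
Local Notation A := (galg k gT).
Local Notation A2 := (galg k (gT * gT)%type).
Local Notation ee := (ee H chi).
Local Notation dtens := (dtens H chi).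
Local Notation Jw := (Jw H chi).
Local Notation diag_ee := (diag_ee H chi).
Hypothesis sum_ee : \sum_x ee x = 1.

Lemma pushf_swap_Jw w : pushf (@swap gT) (Jw w) = Jw (fun x y => w y x).
Proof.
rewrite /Jw (linear_sum (pushf (@swap gT))) [RHS]exchange_big; apply: eq_bigr => x _.
rewrite (linear_sum (pushf (@swap gT))); apply: eq_bigr => y _.
by rewrite (linearZ_LR (pushf (@swap gT))) /= pushf_swap_tens.
Qed.

Lemma DJ_swap w Ji a :
  pushf (@swap gT) (DJ (Jw w) Ji a) = DJ (Jw (fun x y => w y x)) (pushf (@swap gT) Ji) a.
Proof.
rewrite /DJ !(pushfM (@swapM gT)) pushf_swap_Jw; congr (_ * (_ * _)).
by rewrite /cop pushf_comp.
Qed.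

Lemma lext_ee (f : gT -> k^o) x y g : (forall g h, h \in H -> f (g * h)%g = f g * chi y h) ->
  lext f (gel k g * ee x) = (x == y)%:R * f g.
Proof.
move=> fH; rewrite (eeE H chi) -scalerAr (linearZ_LR (lext f)) mulr_sumr (linear_sum (lext f)).
rewrite -(orthogonality k_char0 chi_dual) -mulrA; congr (_ * _); rewrite mulr_suml.
apply: eq_bigr => h hH.
by rewrite -scalerAr (linearZ_LR (lext f)) /= -gelM lext_gel fH // mulrAC -mulrA.
Qed.

(** An equivariant [f] kills [g * ee z] unless [z = y], so the slice sees only the values [w x y] of
    the cocycle. *)
Lemma slice_twist w y (f : gT -> k^o) b :
  (forall g h, h \in H -> f (g * h)%g = f g * chi y h) ->
  slice f (cop b * Jw w) = (\sum_g (b g * f g) *: gel k g) * diag_ee (w^~ y).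
Proof.
move=> fH; rewrite [in LHS](galg_expand b) (linear_sum (@cop k gT)) mulr_suml (linear_sum (slice f)).
rewrite mulr_suml; apply: eq_bigr => g _.
rewrite (linearZ_LR (@cop k gT)) -!scalerAl (linearZ_LR (slice f)) -scalerA; congr (_ *: _).
rewrite /= cop_gel -tens_gel /Jw mulr_sumr (linear_sum (slice f)) mulr_sumr scaler_sumr.
apply: eq_bigr => x _; rewrite mulr_sumr (linear_sum (slice f)) (bigD1 y) //= big1 ?addr0.
  rewrite -scalerAr (linearZ_LR (slice f)) /= tensM slice_tens (lext_ee _ _ fH) eqxx mul1r.
  by rewrite -scalerAr !scalerA mulrC.
move=> z /negbTE zy; rewrite -scalerAr (linearZ_LR (slice f)) /= tensM slice_tens (lext_ee _ _ fH).
by rewrite zy mul0r scale0r scaler0.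
Qed.

Lemma slice_one w y (f : gT -> k^o) :
  (forall g h, h \in H -> f (g * h)%g = f g * chi y h) ->
  slice f (Jw w) = (f 1%g : k) *: diag_ee (w^~ y).
Proof.
move=> fH; rewrite -[Jw w]mul1r -(cop1 k gT) (slice_twist _ _ fH) (bigD1 1%g) //= big1.
  by rewrite addr0 -gel1 gelE eqxx mul1r -scalerAl gel1 mul1r.
by move=> g /negbTE g1; rewrite -gel1 gelE g1 mul0r scale0r.
Qed.

(* [diag_ee c] is grouplike, hence a group element. *)
Lemma diag_ee_grouplike (c : X -> k) :
  (forall x y, c (x * y)%g = c x * c y) -> c 1%g = 1 ->
  exists t, [/\ t \in H, diag_ee c = gel k t & forall x, chi x t = c x].
Proof.
move=> cM c1; set z := diag_ee c.
have zz : cop z = tens z z.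
  rewrite -[LHS]mulr1 -[RHS]mulr1 -(sum_dtens sum_ee) !mulr_sumr; apply: eq_bigr => x _.
  rewrite !mulr_sumr; apply: eq_bigr => y _.
  rewrite tensM !(diag_ee_r k_char0 chi_dual) tensZl tensZr scalerA -cM.
  rewrite (linear_sum (@cop k gT)) mulr_suml (bigD1 (x * y)%g) //= big1 ?addr0.
    by rewrite (linearZ_LR (@cop k gT)) -scalerAl (cop_ee k_char0 chi_dual) eqxx scale1r.
  move=> u /negbTE uxy; rewrite (linearZ_LR (@cop k gT)) -scalerAl (cop_ee k_char0 chi_dual).
  by rewrite uxy scale0r scaler0.
(* Comparing coefficients in the grouplike identity: distinct coefficients multiply to zero and each
   is idempotent, so at most one is nonzero and it equals 1. *)
have zgh g h : z g * z h = (g == h)%:R * z g.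
  have /ffunP /(_ (g, h)) := zz; rewrite copE ffunE tensE /= => <-.
  by case: eqP => _; rewrite ?mul1r ?mul0r.
have [t zt] : exists t, z t != 0.
  apply/existsP; apply: contraT; rewrite negb_exists => /forallP z0.
  have : counit z = 1.
    rewrite (linear_sum (@counit k gT)) (bigD1 1%g) //= big1 ?addr0 => [|x /negbTE x1];
      rewrite (linearZ_LR (@counit k gT)) /= (counit_ee k_char0 chi_dual).
      by rewrite eqxx /GRing.scale /= c1 mulr1.
    by rewrite x1 scaler0.
  rewrite /counit /lext big1; first by move/eqP; rewrite eq_sym oner_eq0.
  by move=> g _; rewrite (eqP (negbNE (z0 g))) scale0r.
have zE : z = gel k t.
  apply/ffunP => h; rewrite gelE; apply: (mulfI zt).
  by rewrite zgh eq_sym mulrC.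
have tH : t \in H.
  apply: contraT => tH; case/eqP: zt; rewrite galg_sumE big1 // => x _.
  by rewrite galgZE ffunE (negbTE tH) mulr0.
exists t; split => // x; have := diag_ee_r k_char0 chi_dual c x.
rewrite -/z zE (gel_ee chi_dual) // => /ffunP /(_ 1%g).
rewrite !galgZE; apply: mulIf; rewrite ffunE group1 invg1 (chix1 chi_dual) mulr1.
by rewrite invr_neq0 // natH_neq0.
Qed.

(** The map [alt w ^~ y] is a character of [X], so it is evaluation at some [t] in [H]. The last
    clause relates the slices of the twist on its two sides. *)
Lemma alt_grouplike w y : is_2cocycle w ->
  exists t, [/\ t \in H, forall x, chi x t = alt w x y &
                diag_ee (w y) * gel k t = diag_ee (w^~ y)].
Proof.
move=> w_coc; have X_ab := abelian_dual chi_dual.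
have [||t [tH tE tx]] := @diag_ee_grouplike (alt w ^~ y).
- by move=> x x'; apply: altM.
- by rewrite /alt (cocycle_x1 w_coc) (cocycle_1x w_coc) divff // w_coc.1.
exists t; split => //; rewrite -tE (diag_eeM k_char0 chi_dual); apply: eq_diag_ee => x.
by rewrite /alt mulrC divfK // w_coc.1.
Qed.

(** Otherwise every nontrivial character sums to zero over [M], so by Fourier expansion the sum of
    the elements of [M] is a multiple of [ee 1], whose support is all of [H]. *)
Lemma proper_character (M : {group gT}) : M \proper H ->
  exists2 x, x != 1%g & {in M, forall h, chi x h = 1}.
Proof.
move=> /properP [MH [h hH hM]].
case: (boolP [exists x, (x != 1%g) && [forall h in M, chi x h == 1]]) => [|nx].
  by case/existsP => x /andP [x1 /forall_inP xM]; exists x => // g /xM /eqP.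
have sumM : \sum_(m in M) gel k m = #|M|%:R *: ee 1%g.
  rewrite (eq_bigr (fun m => \sum_x chi x m *: ee x)); last first.
    by move=> m mM; apply: (gel_sum_ee chi_dual sum_ee); apply: (subsetP MH).
  rewrite exchange_big (bigD1 1%g) //= [X in _ + X]big1 ?addr0 => [|x x1].
    rewrite -scaler_suml; congr (_ *: _).
    by rewrite (eq_bigr (fun=> 1)) ?sumr_const // => m mM; rewrite (chi1 chi_dual) // (subsetP MH).
  rewrite -scaler_suml; suff -> : \sum_(m in M) chi x m = 0 by rewrite scale0r.
  move: nx; rewrite negb_exists => /forallP /(_ x); rewrite x1 /= negb_forall_in.
  by by case/exists_inP => m mM; apply: (chi_sum0 chi_dual MH mM).
have /ffunP /(_ h) := sumM; rewrite galg_sumE big1; last first.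
  by move=> m mM; rewrite gelE; case: eqP => // hm; rewrite hm mM in hM.
rewrite galgZE ffunE hH (chi1 chi_dual) ?groupV // mulr1 => /esym /eqP.
by rewrite mulf_eq0 invr_eq0 !(negbTE (natH_neq0 k_char0 _)).
Qed.

End Slices.

(** * Normal Hopf subalgebras of a twisted group algebra *)

Section LextTheory.
Variables (k : fieldType) (gT : finGroupType).

Lemma eq_lext (V : lmodType k) (F G : gT -> V) a : F =1 G -> lext F a = lext G a.
Proof. by move=> FG; apply: eq_bigr => g _; rewrite FG. Qed.

Lemma lext_comp (V W : lmodType k) (L : {linear V -> W}) (F : gT -> V) a :
  L (lext F a) = lext (fun g => L (F g)) a.
Proof. by rewrite (linear_sum L); apply: eq_bigr => g _; rewrite (linearZ_LR L). Qed.

Lemma lext_mull (B : algType k) u (F : gT -> B) a : lext (fun g => u * F g) a = u * lext F a.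
Proof. by rewrite mulr_sumr; apply: eq_bigr => g _; rewrite scalerAr. Qed.

Lemma lext_mulr (B : algType k) u (F : gT -> B) a : lext (fun g => F g * u) a = lext F a * u.
Proof. by rewrite mulr_suml; apply: eq_bigr => g _; rewrite scalerAl. Qed.

Lemma lext_id (a : galg k gT) : lext (@gel k gT) a = a.
Proof. by rewrite [RHS]galg_expand. Qed.

Lemma lextZ (V : lmodType k) c (F : gT -> V) a : lext (fun g => c *: F g) a = c *: lext F a.
Proof. by rewrite scaler_sumr; apply: eq_bigr => g _; rewrite !scalerA mulrC. Qed.

Lemma lext_scale (V : lmodType k) (F : gT -> k^o) (v : V) a :
  lext (fun g => (F g : k) *: v) a = (lext F a : k) *: v.
Proof. by rewrite scaler_suml; apply: eq_bigr => g _; rewrite scalerA. Qed.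

Lemma mul_gelE (a : galg k gT) g h : (a * gel k g) h = a (h * g^-1)%g.
Proof.
rewrite [LHS]ffunE (bigD1 (h * g^-1)%g) //= big1 ?addr0 => [|x xh].
  by rewrite gelE invMg invgK mulgKV eqxx mulr1.
rewrite gelE; case: eqP => [xg|]; last by rewrite mulr0.
by rewrite -xg invMg invgK mulKVg eqxx in xh.
Qed.

Lemma gel_mulE (a : galg k gT) g h : (gel k g * a) h = a (g^-1 * h)%g.
Proof.
rewrite [LHS]ffunE (bigD1 g) //= big1 ?addr0 => [|x /negbTE xg].
  by rewrite gelE eqxx mul1r.
by rewrite gelE xg mul0r.
Qed.

Lemma lext_shift_r (V : lmodType k) h (F : gT -> V) a :
  lext (fun x => F (x * h)%g) a = lext F (a * gel k h).
Proof.
rewrite [in RHS](galg_expand a) mulr_suml (linear_sum (lext F)); apply: eq_bigr => g _.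
by rewrite -scalerAl (linearZ_LR (lext F)) /= -gelM lext_gel.
Qed.

Lemma lext_shift_l (V : lmodType k) h (F : gT -> V) a :
  lext (fun x => F (h * x)%g) a = lext F (gel k h * a).
Proof.
rewrite [in RHS](galg_expand a) mulr_sumr (linear_sum (lext F)); apply: eq_bigr => g _.
by rewrite -scalerAr (linearZ_LR (lext F)) /= -gelM lext_gel.
Qed.

Lemma lext_coef (u v a : galg k gT) g : lext (fun x => (u * gel k x * v) g : k^o) a = (u * a * v) g.
Proof.
rewrite [in RHS](galg_expand a) mulr_sumr mulr_suml galg_sumE.
by apply: eq_bigr => x _; rewrite -scalerAr -scalerAl galgZE.
Qed.

End LextTheory.

Section HopfSubalgebra.
Variables (k : fieldType) (gT : finGroupType).
Local Notation A := (galg k gT).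
Local Notation A2 := (galg k (gT * gT)%type).
Local Notation copJ := (@DJ k gT).

Record is_twist (J Ji : A2) : Prop := IsTwist {
  twistK : J * Ji = 1;
  twistVK : Ji * J = 1;
  twist_cocycle : copL J * inj12 J = copR J * inj23 J;
  twist_counR : forall a, counR (copJ J Ji a) = a;
  twist_counL : forall a, counR (pushf (@swap gT) (copJ J Ji a)) = a
}.

Record is_antip (J Ji : A2) (S : gT -> A) : Prop := IsAntip {
  antip_l : forall a,
    lext (fun x : gT * gT => S x.1 * gel k x.2) (copJ J Ji a) = (counit a : k) *: 1;
  antip_r : forall a,
    lext (fun x : gT * gT => gel k x.1 * S x.2) (copJ J Ji a) = (counit a : k) *: 1
}.

Definition adjact (J Ji : A2) (S : gT -> A) (a x : A) : A :=
  lext (fun y : gT * gT => gel k y.1 * x * S y.2) (copJ J Ji a).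

Record is_normal_sub (J Ji : A2) (S : gT -> A) (B : A -> Prop) : Prop := IsNormalSub {
  sub0 : B 0;
  subD : forall a b, B a -> B b -> B (a + b);
  subZ : forall c a, B a -> B (c *: a);
  sub1 : B 1;
  subM : forall a b, B a -> B b -> B (a * b);
  sub_cop : forall a, B a -> exists n (b c : 'I_n -> A),
    (forall i, B (b i) /\ B (c i)) /\ copJ J Ji a = \sum_(i < n) tens (b i) (c i);
  sub_antip : forall a, B a -> B (lext S a);
  sub_adj : forall a x, B x -> B (adjact J Ji S a x)
}.

Variables J Ji : A2.
Hypothesis J_twist : is_twist J Ji.
Variable S : gT -> A.
Hypothesis S_antip : is_antip J Ji S.
Local Notation D := (DJ J Ji).
Local Notation adjJ := (adjact J Ji S).
Let JK := twistK J_twist.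
Let JiK := twistVK J_twist.
Let Jcoc := twist_cocycle J_twist.
Let counR_D := twist_counR J_twist.
Let counL_D := twist_counL J_twist.
Let S_l := antip_l S_antip.
Let S_r := antip_r S_antip.

Lemma lext_fst (V : lmodType k) (F : gT -> V) a :
  lext (fun x : gT * gT => F x.1) (D a) = lext F a.
Proof. by rewrite -{2}[a]counR_D /counR lext_pushf. Qed.

Lemma lext_snd (V : lmodType k) (F : gT -> V) a :
  lext (fun x : gT * gT => F x.2) (D a) = lext F a.
Proof. by rewrite -{2}[a]counL_D /counR !lext_pushf. Qed.

(** In Sweedler notation, [a_1 x S(a_2) a_3 = a x]: this is how normality moves an element of [B] to
    the left of [a]. *)
Lemma adjJ_cancel a x : lext (fun y : gT * gT => adjJ (gel k y.1) x * gel k y.2) (D a) = a * x.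
Proof.
have := coassoc_lext JK JiK Jcoc (fun g h l => gel k g * x * S h * gel k l) a.
under eq_lext => y do rewrite lext_mulr.
move=> ->; under eq_lext => y.
  under eq_lext => z do rewrite -mulrA.
  rewrite lext_mull S_l counit_gel scale1r mulr1; over.
by rewrite lext_mulr (lext_fst (@gel k gT)) lext_id.
Qed.

Lemma counit_adjJ a x : counit (adjJ a x) = counit a * counit x.
Proof.
have <- : counit (lext (fun y : gT * gT => gel k y.1 * S y.2) (D a)) = counit a.
  by rewrite S_r linearZ /= counit1 /GRing.scale /= mulr1.
rewrite !lext_comp mulrC -lext_mull; apply: eq_lext => y.
by rewrite /= !counitM counit_gel !mul1r.
Qed.

(** A left and a right convolution inverse of the identity coincide: evaluate [S0(a_1) a_2 S(a_3)]
    in two ways. *)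
Lemma antip_unique (S0 : {linear A -> A}) :
  (forall a, lext (fun x : gT * gT => S0 (gel k x.1) * gel k x.2) (D a) = (counit a : k) *: 1) ->
  forall a, lext S a = S0 a.
Proof.
move=> S0_l a.
have := coassoc_lext JK JiK Jcoc (fun g h l => S0 (gel k g) * gel k h * S l) a.
under eq_lext => y do rewrite lext_mulr S0_l counit_gel scale1r mul1r.
rewrite (lext_snd S) => ->; under eq_lext => y.
  under eq_lext => z do rewrite -mulrA.
  rewrite lext_mull S_r counit_gel scale1r mulr1; over.
by rewrite (lext_fst (fun g => S0 (gel k g))) -[in RHS](lext_id a) lext_comp.
Qed.

Lemma tens_antip_cancel a :
  lext (fun x : gT * gT => D (gel k x.1) * tens 1 (S x.2)) (D a) = tens a 1.
Proof.
have := coassoc_lext JK JiK Jcoc (fun g h l => tens (gel k g) (gel k h * S l)) a.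
under eq_lext => y.
  under eq_lext => z do rewrite -[gel k z.1]mulr1 -tensM tens_gel -surjective_pairing.
  rewrite lext_mulr lext_id; over.
move=> ->; under eq_lext => y.
  rewrite -(lext_comp (tens (gel k y.1))) S_r counit_gel scale1r; over.
rewrite (lext_fst (fun g => tens (gel k g) 1)).
by rewrite [in RHS](galg_expand a) tens_suml; apply: eq_bigr => g _; rewrite tensZl.
Qed.

Variable B : A -> Prop.
Hypothesis B_normal : is_normal_sub J Ji S B.
Let B0 := sub0 B_normal.
Let BD := subD B_normal.
Let BZ := subZ B_normal.
Let B1 := sub1 B_normal.
Let BM := subM B_normal.
Let B_cop := sub_cop B_normal.
Let B_antip := sub_antip B_normal.
Let B_adj := sub_adj B_normal.

Lemma B_sum I r (P : pred I) (F : I -> A) :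
  (forall i, P i -> B (F i)) -> B (\sum_(i <- r | P i) F i).
Proof. by move=> BF; apply: big_ind. Qed.

(* The functions vanishing, as functionals, on the ideal [B^+ A]. *)
Definition invfun (f : gT -> k^o) : Prop :=
  forall b, B b -> forall g, lext f (b * gel k g) = counit b * f g.

Lemma invfun_const c : invfun (fun=> c).
Proof.
move=> b _ g; rewrite (_ : lext _ _ = (counit (b * gel k g) : k) *: (c : k^o)).
  by rewrite counitM counit_gel mulr1.
by rewrite /counit -lext_scale; apply: eq_lext => h; rewrite scale1r.
Qed.

Lemma invfunD f f' : invfun f -> invfun f' -> invfun (fun x => f x + f' x).
Proof.
move=> Vf Vf' b Bb g; rewrite mulrDr -Vf // -Vf' //.
by rewrite /lext -big_split; apply: eq_bigr => x _; rewrite scalerDr.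
Qed.

Lemma invfunZ c f : invfun f -> invfun (fun x => c * f x).
Proof.
move=> Vf b Bb g; rewrite mulrCA -Vf // -[RHS]/((c : k) *: (lext f _ : k^o)).
by rewrite -lextZ.
Qed.

Lemma invfun_r h f : invfun f -> invfun (fun x => f (x * h)%g).
Proof.
by move=> Vf b Bb g; rewrite lext_shift_r -mulrA -gelM Vf. Qed.

(** By [adjJ_cancel], [h b] equals the sum of [(h_1 . b) h_2], and normality keeps [h_1 . b] in [B]:
    the right ideal generated by the augmentation ideal of [B] is two-sided. *)
Lemma invfun2 f b g h : invfun f -> B b ->
  lext f (gel k h * b * gel k g) = counit b * f (h * g)%g.
Proof.
move=> Vf Bb; rewrite -(adjJ_cancel (gel k h) b) -lext_mulr (lext_comp (lext f)).
rewrite (eq_lext (G := fun y : gT * gT => counit b * f (y.2 * g)%g)); last first.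
  move=> y /=; rewrite -mulrA -gelM Vf; last exact: B_adj.
  by rewrite counit_adjJ counit_gel mul1r.
by rewrite (lext_mull (B := k^o)) (lext_snd (fun l => f (l * g)%g)) lext_gel.
Qed.

Lemma invfun_l h f : invfun f -> invfun (fun x => f (h * x)%g).
Proof. by move=> Vf b Bb g; rewrite lext_shift_l mulrA invfun2. Qed.

(** A product of functions is dual to the untwisted coproduct, which is [J * D b * Ji] with [D b] in
    the tensor square of [B]. By [invfun2] each leg of [D b] contributes only its counit, whatever
    surrounds it, and then [J * Ji] cancels. *)
Lemma invfunM f f' : invfun f -> invfun f' -> invfun (fun x => f x * f' x).
Proof.
move=> Vf Vf' b Bb g; move Eb: (counit b) => u; pose F (x : gT * gT) : k^o := f x.1 * f' x.2.
have F_tens a c : lext F (tens a c) = lext f a * lext f' c.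
  apply: (tens_ext (F := lext F) (B := fun a c => lext f a * lext f' c : k^o)) => {a c}.
  - by move=> c d a a'; rewrite linearP mulrDl -scalerAl.
  - by move=> a d c c'; rewrite linearP mulrDr -scalerAr.
  by move=> x y; rewrite /= !lext_gel.
have F2 T T' c d : B c -> B d -> 
    lext F (T * tens c d * T') = (counit c * counit d : k) *: lext F (T * T').
  move=> Bc Bd; move uE: (counit c * counit d) => v.
  rewrite [T]galg_expand !mulr_suml !(linear_sum (lext F)) scaler_sumr.
  apply: eq_bigr => -[x y] _; rewrite -!scalerAl !(linearZ_LR (lext F)) scalerA mulrC -scalerA; congr (_ *: _).
  rewrite [T']galg_expand !mulr_sumr !(linear_sum (lext F)) scaler_sumr.
  apply: eq_bigr => -[x' y'] _; rewrite -!scalerAr !(linearZ_LR (lext F)) scalerA mulrC -scalerA; congr (_ *: _).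
  rewrite /= -gelM lext_gel -!tens_gel !tensM F_tens !invfun2 //.
  by rewrite -uE mulrACA.
have -> : lext (fun x => f x * f' x : k^o) (b * gel k g) = lext F (cop b * gel k (g, g)).
  by rewrite -cop_gel -copM /cop lext_pushf.
have [n [c [d [Bcd Db]]]] := B_cop Bb.
have -> : cop b = J * D b * Ji by rewrite -cop_DJ // -mulrA JK mulr1.
rewrite Db mulr_sumr !mulr_suml (linear_sum (lext F)).
rewrite (eq_bigr (fun i => counit (c i) * counit (d i) * (f g * f' g))); last first.
  move=> i _; have [Bc Bd] := Bcd i; rewrite /= -(mulrA _ Ji) F2 // (mulrA J) JK mul1r.
  by rewrite lext_gel.
rewrite -mulr_suml; congr (_ * _); rewrite -Eb -[in RHS](counR_D b) Db (linear_sum (@counR k gT)) (linear_sum (@counit k gT)).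
by apply: eq_bigr => i _; rewrite /= counR_tens (linearZ_LR (@counit k gT)) mulrC.
Qed.

(* The slice of [Delta(b) J = J Delta^J(b)]: the second leg of [Delta^J(b)]
   lies in [B], where [f] acts through the counit up to translation. *)
Lemma slice_invfun f b (J' D' : A2) n (c d : 'I_n -> A) : invfun f ->
  cop b * J' = J' * D' -> D' = \sum_(i < n) tens (c i) (d i) -> (forall i, B (d i)) ->
  counR D' = b -> slice f (cop b * J') = slice f J' * b.
Proof.
move=> Vf -> -> Bd <-; rewrite [J']galg_expand mulr_suml !(linear_sum (slice f)) mulr_suml.
apply: eq_bigr => -[g h] _; rewrite -scalerAl !(linearZ_LR (slice f)) -scalerAl; congr (_ *: _).
rewrite (linear_sum (@counR k gT)) !mulr_sumr (linear_sum (slice f)); apply: eq_bigr => i _.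
rewrite /= -tens_gel tensM !slice_tens counR_tens -[_ * d i]mulr1 -gel1 invfun2 // mulg1.
by rewrite lext_gel -scalerAl -scalerAr scalerA mulrC.
Qed.

(* The normal subgroup [N] for which the quotient of [A] by [B^+ A] is [k(G/N)]. *)
Definition invker : {set gT} := [set x | `[< forall f, invfun f -> f x = f 1%g >]].

Lemma invkerP x : reflect (forall f, invfun f -> f x = f 1%g) (x \in invker).
Proof. by rewrite inE; apply: asboolP. Qed.

Lemma invker_group_set : group_set invker.
Proof.
apply/group_setP; split=> [|x y /invkerP Nx /invkerP Ny]; apply/invkerP => // f Vf.
by rewrite (Nx _ (invfun_r y Vf)) mul1g Ny.
Qed.
Canonical invker_group := Group invker_group_set.

Lemma invker_normal : (invker <| [set: gT])%g.
Proof.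
rewrite /normal subsetT; apply/subsetP => g _; rewrite inE; apply/subsetP => _ /imsetP [x Nx ->].
apply/invkerP => f Vf; move/invkerP: Nx => Nx; rewrite conjgE.
by rewrite mulgA (Nx _ (invfun_l g^-1%g (invfun_r g Vf))) mulg1 mulVg.
Qed.

(** Interpolation: for each [y] outside [invker] some invariant function separates [y] from 1;
    normalized to vanish at [y] and to equal 1 on [invker], these are multiplied together, and the
    result is translated. *)
Lemma invfun_indicator g h : invfun (fun x => ((g * x * h)%g \in invker)%:R).
Proof.
suff [f [Vf f1 f0]] : exists f, [/\ invfun f, {in invker, forall x, f x = 1} &
    forall y, y \in enum gT -> y \notin invker -> f y = 0].
  rewrite (_ : (fun x => _) = fun x => f (g * x * h)%g); last first.
    apply/funext => x; case: (boolP (_ \in _)) => [/f1 -> //|/f0 -> //].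
    by rewrite mem_enum.
  exact: (invfun_l g (invfun_r h Vf)).
elim: (enum gT) => [|y s [f [Vf f1 f0]]].
  by exists (fun=> 1); split => //; apply: invfun_const.
case: (boolP (y \in invker)) => [yN|/invkerP yN].
  exists f; split => // z; rewrite inE => /orP [/eqP ->|/f0 //].
  by rewrite yN.
have [f' [Vf' yf']] : exists f', invfun f' /\ f' y <> f' 1%g.
  move/existsNP: yN => [f' /not_implyP]; by exists f'.
have d0 : f' 1%g - f' y != 0 by rewrite subr_eq0; apply/eqP => e; apply: yf'.
exists (fun x => f x * ((f' 1%g - f' y)^-1 * (f' x + - f' y))); split.
- apply: invfunM => //; apply: invfunZ; apply: invfunD => //; exact: invfun_const.
- by move=> x xN; rewrite f1 // (invkerP _ xN f') // mulVf // mulr1.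
move=> z; rewrite inE => /orP [/eqP ->|zs zN]; first by rewrite subrr !mulr0.
by rewrite f0 // mul0r.
Qed.

(** Every point indicator is then invariant, and pairing [b] with the one at [g] reads off the
    coefficient of [g]. *)
Lemma invker_trivial : invker \subset [1]%g -> forall b, B b -> b = (counit b : k) *: 1.
Proof.
move=> N1 b Bb; apply/ffunP => g; have := invfun_indicator 1%g g^-1%g Bb 1%g.
rewrite gel1 mulr1 -gel1 galgZE gelE !mul1g.
have N1E x : (x \in invker) = (x == 1%g).
  by apply/idP/eqP => [/(subsetP N1) /set1P //|->]; apply: group1.
rewrite N1E eq_invg1 => <-; rewrite {1}[b]galg_expand galg_sumE.
by apply: eq_bigr => x _; rewrite mul1g N1E -eq_mulgV1 galgZE gelE eq_sym.
Qed.

(** The indicator of a subgroup supporting all of [B] is an invariant function, so its value on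
    [invker] is its value at 1. *)
Lemma invker_sub_support (C : {group gT}) :
  (forall b g, B b -> b g != 0 -> g \in C) -> invker \subset C.
Proof.
move=> BC; apply/subsetP => x /invkerP /(_ (fun x => (x \in C)%:R)).
rewrite group1 => Nx; case: (x \in C) Nx => // Nx; exfalso.
suff /Nx /eqP : invfun (fun x => (x \in C)%:R) by rewrite eq_sym oner_eq0.
move=> b Bb g; rewrite -lext_shift_r /counit -lext_mulr; apply: eq_bigr => y _.
case: (eqVneq (b y) 0) => [->|/(BC _ _ Bb) yC]; first by rewrite !scale0r.
by rewrite groupMl // mul1r.
Qed.

(** Since [t (x) 1] commutes with the twist and with the tensor square of [B], it commutes with the
    untwisted coproduct of [b]; the coefficients at [(g t, g)] then force [t^-1 g t = g] wherever
    [b g] is nonzero. *)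
Lemma commuting_support b t :
  (forall c, B c -> c * gel k t = gel k t * c) ->
  J * tens (gel k t) 1 = tens (gel k t) 1 * J -> B b ->
  forall g, b g != 0 -> g \in 'C[t]%g.
Proof.
move=> Bt Jt Bb g bg; have [n [c [d [Bcd Db]]]] := B_cop Bb.
have Dt : D b * tens (gel k t) 1 = tens (gel k t) 1 * D b.
  rewrite Db mulr_suml mulr_sumr; apply: eq_bigr => i _.
  by rewrite !tensM Bt ?mulr1 ?mul1r //; case: (Bcd i).
have cD : cop b = J * D b * Ji by rewrite -cop_DJ // -mulrA JK mulr1.
have Jit : Ji * tens (gel k t) 1 = tens (gel k t) 1 * Ji.
  by rewrite -[RHS]mul1r -JiK -!mulrA (mulrA J) Jt -!mulrA JK mulr1.
have : cop b * tens (gel k t) 1 = tens (gel k t) 1 * cop b.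
  move: (D b) (tens (gel k t) 1) Dt cD Jit Jt => T u Dt -> Jit Jt.
  by rewrite -!mulrA Jit (mulrA T) Dt !mulrA Jt.
rewrite -gel1 tens_gel => /ffunP /(_ (g * t, g)%g); rewrite mul_gelE gel_mulE !copE !ffunE /=.
rewrite mulgK invg1 mulg1 mul1g eqxx; case: eqP => [tg _|_ /eqP]; last by rewrite (negbTE bg).
by apply/cent1P; apply: (mulgI t^-1%g); rewrite tg mulKg.
Qed.

(** [B] is only a predicate; enlarging a subspace inside it until the dimension stops growing yields
    a finite basis, needed for the trace. *)
Lemma exists_vspace : exists U : {vspace A}, forall x, x \in U <-> B x.
Proof.
suff H n : forall U : {vspace A}, (forall x, x \in U -> B x) -> (\dim {:A} - \dim U <= n)%N ->
    exists U : {vspace A}, forall x, x \in U <-> B x.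
  by apply: (H _ 0%VS) => // x; rewrite memv0 => /eqP ->.
elim: n => [|n IHn] U UB dU.
  exists U => x; split; first exact: UB.
  move=> _; suff -> : U = fullv by rewrite memvf.
  by apply/eqP; rewrite eqEdim subvf -subn_eq0 -leqn0.
have [[x [Bx xU]]|nB] := pselect (exists x, B x /\ x \notin U); last first.
  exists U => x; split; first exact: UB.
  by move=> Bx; apply: contrapT => /negP xU; apply: nB; exists x.
apply: (IHn (U + <[x]>)%VS).
  by move=> _ /memv_addP [u uU [_ /vlineP [c ->] ->]]; apply: BD; [apply: UB|apply: BZ].
have UUx : (\dim U < \dim (U + <[x]>))%N.
  rewrite ltnNge; apply: contra xU => le_d.
  have /eqP -> : U == (U + <[x]>)%VS by rewrite eqEdim addvSl.
  by apply: (subvP (addvSr _ _)); apply: memv_line.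
have UxF : (\dim (U + <[x]>) <= \dim {:A})%N by rewrite dimvS ?subvf.
by move: dU UUx UxF; lia.
Qed.

Hypothesis S_op : forall a,
  lext (fun x : gT * gT => S x.2 * gel k x.1) (D a) = (counit a : k) *: 1.

(* The integral is the trace of the coproduct over [B]; the identity
   [S (b_2) b_1 = counit b] is where [S^2 = id] enters. *)
Lemma exists_integral : [pchar k] =i pred0 -> exists L : A,
  [/\ B L, counit L != 0 & forall b, B b -> L * b = (counit b : k) *: L].
Proof.
move=> k0; have [U UB] := exists_vspace.
pose n := \dim U; pose e (i : 'I_n) : A := (vbasis U)`_i.
pose f i (g : gT) : k^o := coord (vbasis U) i (gel k g).
have Be i : B (e i) by apply/UB/vbasis_mem/mem_nth; rewrite size_tuple.
have fE i a : lext (f i) a = coord (vbasis U) i a.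
  by rewrite -[in RHS](lext_id a) (lext_comp (coord (vbasis U) i : {linear A -> k^o})).
have fB b : B b -> b = \sum_i (lext (f i) b : k) *: e i.
  by move=> /UB bU; rewrite [LHS](coord_vbasis bU); apply: eq_bigr => i _; rewrite fE.
have fe i : lext (f i) (e i) = 1.
  by rewrite fE /e coord_free ?eqxx //; apply: (basis_free (vbasisP U)).
(* Coproducts of the basis, paired with the dual basis on the second leg. The counit of the result
   is the dimension of [B], nonzero in characteristic zero. *)
exists (\sum_i slice (f i) (D (e i))); split.
- apply: B_sum => i _; have [m [c [d [Bcd ->]]]] := B_cop (Be i).
  rewrite (linear_sum (slice (f i))); apply: B_sum => j _.
  by rewrite /= slice_tens; apply: BZ; case: (Bcd j).
- rewrite (linear_sum (@counit k gT)) (eq_bigr (fun=> 1)); last first.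
    move=> i _; rewrite /= /slice (lext_comp (@counit k gT)).
    rewrite (eq_lext (G := fun x : gT * gT => f i x.2)) ?lext_snd ?fe // => x.
    by rewrite linearZ /= counit_gel /GRing.scale /= mulr1.
  rewrite sumr_const card_ord ((pcharf0P k).1 k0); apply/negP => /eqP n0.
  have /UB : B 1 by [].
  move: (n0) => /eqP; rewrite dimv_eq0 => /eqP ->.
  by rewrite memv0 oner_eq0.
move=> b Bb; have [m [c [d [Bcd Db]]]] := B_cop Bb.
(* The Sweedler identity [b (x) 1 = b_1 (x) b_2 S(b_3)]. *)
have b1 : tens b 1 = \sum_(l < m) D (c l) * tens 1 (lext S (d l)).
  rewrite -tens_antip_cancel Db; set G := fun x : gT * gT => _.
  rewrite (linear_sum (lext G)); apply: eq_bigr => l _.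
  rewrite /= lext_tens /G /=; under [LHS]eq_lext => g.
    rewrite lext_mull -(lext_comp (tens 1)); over.
  by rewrite lext_mulr -(lext_comp (DJ J Ji)) lext_id.
have Sdc : \sum_(l < m) lext S (d l) * c l = (counit b : k) *: 1.
  rewrite -S_op Db; set G := fun x : gT * gT => _.
  rewrite (linear_sum (lext G)); apply: eq_bigr => l _.
  rewrite /= lext_tens /G /=; under [RHS]eq_lext => g do rewrite lext_mulr.
  by rewrite lext_mull lext_id.
(* Cyclicity of the trace: right multiplication by [x] before the coproduct may be performed after
   it, on the traced leg. *)
have trace_cycl s x : B s -> B x -> \sum_i slice (f i) (D (e i * x) * tens 1 s) =
    \sum_j slice (f j) (D (e j) * tens 1 (s * x)).
  move=> Bs Bx; rewrite (eq_bigr (fun i => \sum_j (lext (f j) (e i * x) : k) *: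
      slice (f i) (D (e j) * tens 1 s))); last first.
    move=> i _; have -> : D (e i * x) = \sum_j (lext (f j) (e i * x) : k) *: D (e j).
      have /(congr1 D) := fB _ (BM (Be i) Bx); rewrite (linear_sum (DJ J Ji)) => ->.
      by apply: eq_bigr => j _; rewrite (linearZ_LR (DJ J Ji)).
    rewrite mulr_suml (linear_sum (slice (f i))); apply: eq_bigr => j _.
    by rewrite -scalerAl (linearZ_LR (slice (f i))).
  rewrite exchange_big; apply: eq_bigr => j _.
  have [r [p [q [Bpq De]]]] := B_cop (Be j); rewrite De.
  under eq_bigr => i _.
    rewrite mulr_suml (linear_sum (slice (f i))) scaler_sumr.
    under eq_bigr => l _ do rewrite /= tensM mulr1 slice_tens scalerA.
    over.
  rewrite exchange_big mulr_suml (linear_sum (slice (f j))); apply: eq_bigr => l _.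
  rewrite /= tensM mulr1 slice_tens -scaler_suml; congr (_ *: _).
  have Bqs : B (q l * s) by apply: BM => //; case: (Bpq l).
  rewrite mulrA {2}(fB _ Bqs) mulr_suml (linear_sum (lext (f j))); apply: eq_bigr => i _.
  by rewrite -scalerAl (linearZ_LR (lext (f j))) mulrC.
have slice_mulr i T : slice (f i) T * b = slice (f i) (T * tens b 1).
  rewrite [T]galg_expand [in RHS]mulr_suml !(linear_sum (slice (f i))) mulr_suml.
  apply: eq_bigr => -[g h] _; rewrite -scalerAl !(linearZ_LR (slice (f i))) -scalerAl.
  by rewrite /= -tens_gel tensM mulr1 !slice_tens -scalerAl.
rewrite mulr_suml; under eq_bigr => i _ do rewrite slice_mulr b1 mulr_sumr (linear_sum (slice (f i))).
rewrite exchange_big (eq_bigr (fun l => \sum_j slice (f j) (D (e j) * tens 1 (lext S (d l) * c l)))).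
  rewrite exchange_big scaler_sumr; apply: eq_bigr => j _.
  rewrite -(linear_sum (slice (f j))) -mulr_sumr -tens_sumr Sdc tensZr tens1.
  by rewrite -scalerAr mulr1 (linearZ_LR (slice (f j))).
move=> l _; rewrite -trace_cycl; first by apply: eq_bigr => i _; rewrite /= (mulrA (D _)) -DJM.
  by apply: B_antip; case: (Bcd l).
by case: (Bcd l).
Qed.

(** The translated coefficients of an integral [L] are invariant functions because [L * b] is a
    multiple of [L]. They are constant when [invker] is everything, so [L] is a nonzero multiple of
    the sum of all group elements. *)
Lemma invker_full : [pchar k] =i pred0 -> [set: gT] \subset invker ->
  B (\sum_g gel k g).
Proof.
move=> k0 /subsetP NT; have [L [BL L0 Lb]] := exists_integral k0.
have mulL a h : (L * a) h = lext (fun g => L (h * g^-1)%g : k^o) a.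
  rewrite [in LHS](galg_expand a) mulr_sumr galg_sumE; apply: eq_bigr => g _.
  by rewrite -scalerAr galgZE mul_gelE.
have VL h : invfun (fun g => L (h * g^-1)%g).
  by move=> b Bb g; rewrite -mulL mulrA Lb // -scalerAl galgZE mul_gelE.
have LE : L = L 1%g *: \sum_g gel k g.
  rewrite scaler_sumr [LHS]galg_expand; apply: eq_bigr => g _; congr (_ *: _).
  have /invkerP /(_ _ (VL 1%g)) := NT g^-1%g (in_setT _).
  by rewrite !invgK invg1 !mul1g.
have L1 : L 1%g != 0.
  by apply: contraNneq L0 => L1; rewrite LE L1 scale0r linear0.
by rewrite -[X in B X](scalerK L1) -LE; apply: BZ.
Qed.

End HopfSubalgebra.

(** * Subalgebras for a twist by a cocycle *)

Section TwistedSubalgebra.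
Variables (k : fieldType) (k_char0 : [pchar k] =i pred0).
Variables (gT : finGroupType) (H : {group gT}).
Variables (X : finGroupType) (chi : X -> gT -> k).
Hypothesis chi_dual : dual_group_param H chi.
Local Notation A := (galg k gT).
Local Notation A2 := (galg k (gT * gT)%type).
Local Notation ee := (ee H chi).
Local Notation dtens := (dtens H chi).
Local Notation Jw := (Jw H chi).
Local Notation diag_ee := (diag_ee H chi).
Hypothesis sum_ee : \sum_x ee x = 1.
Variable w : X -> X -> k.
Hypothesis w_coc : is_2cocycle w.
Let w' x y := (w x y)^-1.
Local Notation J := (Jw w).
Local Notation Ji := (Jw w').
Local Notation D := (DJ J Ji).

Let w0 x y : w x y != 0. Proof. by case: w_coc. Qed.
Let JK : J * Ji = 1. Proof. by case: (Jw_inv k_char0 chi_dual sum_ee w0). Qed.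
Let JiK : Ji * J = 1. Proof. by case: (Jw_inv k_char0 chi_dual sum_ee w0). Qed.

Let dtensE x y : dtens x y = tens (ee x) (ee y). Proof. by []. Qed.

Lemma sum_gel_l a : tens a 1 * cop (\sum_g gel k g) = tens 1 (antip a) * cop (\sum_g gel k g) :> A2.
Proof.
rewrite [a]galg_expand tens_suml (linear_sum (@antip k gT)) tens_sumr !mulr_suml; apply: eq_bigr => h _.
rewrite tensZl (linearZ_LR (@antip k gT)) tensZr -!scalerAl; congr (_ *: _).
rewrite (linear_sum (@cop k gT)) !mulr_sumr [RHS](reindex_inj (mulgI h)) /=; apply: eq_bigr => g _.
by rewrite antip_gel !cop_gel -gel1 !tens_gel -!gelM; congr gel; congr pair; rewrite ?mul1g ?mulKg.
Qed.

Lemma sum_gel_r a : cop (\sum_g gel k g) * tens a 1 = cop (\sum_g gel k g) * tens 1 (antip a) :> A2.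
Proof.
rewrite [a]galg_expand tens_suml (linear_sum (@antip k gT)) tens_sumr !mulr_sumr; apply: eq_bigr => h _.
rewrite tensZl (linearZ_LR (@antip k gT)) tensZr -!scalerAr; congr (_ *: _).
rewrite (linear_sum (@cop k gT)) !mulr_suml [RHS](reindex_inj (mulIg h)) /=; apply: eq_bigr => g _.
by rewrite antip_gel !cop_gel -gel1 !tens_gel -!gelM; congr gel; congr pair; rewrite ?mulg1 ?mulgK.
Qed.

(** Invariance of the integral transfers the first leg of the twist, through the antipode, to the
    second leg, where orthogonality keeps only the pairs [x^-1, x]. *)
Lemma Jw_sum_gel_l v : Jw v * cop (\sum_g gel k g) =
  tens 1 (diag_ee (fun x => v x^-1%g x)) * cop (\sum_g gel k g).
Proof.
rewrite /Jw (reindex_inj invg_inj) mulr_suml /diag_ee tens_sumr mulr_suml.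
apply: eq_bigr => x _; rewrite mulr_suml (bigD1 x) //= [X in _ + X]big1 ?addr0 => [|y /negbTE yx];
  rewrite -scalerAl dtensE -[ee x^-1%g]mul1r -[X in tens _ X]mulr1 -tensM -mulrA sum_gel_l mulrA tensM;
  rewrite mul1r (antip_ee chi_dual) invgK (ee_orth k_char0 chi_dual).
  by rewrite eqxx scale1r tensZr scalerAl.
by rewrite yx scale0r linear0 mul0r scaler0.
Qed.

Lemma Jw_sum_gel_r v : cop (\sum_g gel k g) * Jw v =
  cop (\sum_g gel k g) * tens 1 (diag_ee (fun x => v x^-1%g x)).
Proof.
rewrite /Jw mulr_sumr (reindex_inj invg_inj) /diag_ee tens_sumr mulr_sumr.
apply: eq_bigr => x _; rewrite mulr_sumr (bigD1 x) //= [X in _ + X]big1 ?addr0 => [|y /negbTE yx];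
  rewrite -scalerAr dtensE -[ee x^-1%g]mulr1 -[X in tens _ X]mul1r -tensM mulrA sum_gel_r -mulrA tensM;
  rewrite mulr1 (antip_ee chi_dual) invgK (ee_orth k_char0 chi_dual).
  by rewrite eqxx scale1r tensZr scalerAr.
by rewrite eq_sym yx scale0r linear0 mulr0 scaler0.
Qed.

(* [Delta^J] of the integral of [kG] is nondegenerate. *)
Lemma sum_gel_generates (B : A -> Prop) n (b c : 'I_n -> A) :
  D (\sum_g gel k g) = \sum_(i < n) tens (b i) (c i) -> (forall i, B (b i)) ->
  (forall x y, B x -> B y -> B (x + y)) -> (forall c x, B x -> B (c *: x)) -> B 0 -> 
  forall a, B a.
Proof.
move=> DE Bb BD BZ B0.
have B_sum I r (P : pred I) (F : I -> A) : (forall i, P i -> B (F i)) -> B (\sum_(i <- r | P i) F i).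
  by move=> BF; apply: big_ind.
suff Bg g : B (gel k g) by move=> a; rewrite [a]galg_expand; apply: B_sum => g _; apply: BZ.
pose U := diag_ee (fun x => w x^-1%g x); pose U' := diag_ee (fun x => w' x^-1%g x).
have UU' : U * U' = 1 by apply: (diag_ee_unit k_char0 chi_dual sum_ee) => x; rewrite /w' divff.
(* The twisted coproduct of the integral is the sum of [h (x) U' h U]; this functional undoes [U']
   and [U] and extracts the coefficient at [g]. *)
pose f x : k^o := (U * gel k x * U') g.
have fl y : lext f y = (U * y * U') g by apply: lext_coef.
have <- : slice f (D (\sum_g gel k g)) = gel k g.
  rewrite /DJ Jw_sum_gel_r mulrA Jw_sum_gel_l -/U -/U'.
  rewrite (linear_sum (@cop k gT)) mulr_sumr mulr_suml (linear_sum (slice f)) (bigD1 g) //=.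
  have sl h : slice f (tens 1 U' * cop (gel k h) * tens 1 U) = (gel k h g) *: gel k h.
    rewrite cop_gel -tens_gel !tensM mul1r mulr1 slice_tens; congr (_ *: _).
    by rewrite fl !mulrA UU' mul1r -mulrA UU' mulr1.
  rewrite sl gelE eqxx scale1r big1 ?addr0 // => h /negbTE hg.
  by rewrite sl gelE eq_sym hg scale0r.
rewrite DE (linear_sum (slice f)); apply: B_sum => i _.
by rewrite /= slice_tens; apply: BZ.
Qed.

(** The cocycle of the flipped twist, which makes statements about one leg available for the
    other. *)
Let wop x y := w y x.
Let wop_coc : is_2cocycle wop.
Proof.
split=> [x y|x y z]; first exact: w0.
have X_ab := abelian_dual chi_dual; rewrite /wop (X_ab x y) (X_ab y z).
by case: w_coc => _ ->.
Qed.

Let swapJi : pushf (@swap gT) Ji = Jw (fun x y => (wop x y)^-1).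
Proof. exact: pushf_swap_Jw. Qed.

Lemma Jw_twist : is_twist J Ji.
Proof.
split=> //; first exact: (Jw_cocycle k_char0 chi_dual sum_ee).
  by move=> a; apply: (counR_DJ k_char0 chi_dual sum_ee) => // x; apply: (cocycle_x1 w_coc).
move=> a; rewrite DJ_swap swapJi.
apply: (counR_DJ k_char0 chi_dual sum_ee); last by move=> x; apply: (cocycle_x1 wop_coc).
by case: (Jw_inv k_char0 chi_dual sum_ee wop_coc.1).
Qed.

Variable S : gT -> A.
Hypothesis S_antip : is_antip J Ji S.

(** By uniqueness [S] is [antipJ], whose formula is the same for [w] and for the flipped cocycle
    since [w x x^-1 = w x^-1 x]. So [S] also serves the opposite coproduct. *)
Lemma antip_op a :
  lext (fun x : gT * gT => S x.2 * gel k x.1) (D a) = (counit a : k) *: 1.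
Proof.
have SE : forall b, lext S b = antipJ H chi w b.
  apply: (antip_unique Jw_twist S_antip (S0 := antipJ H chi w)) => b.
  exact: (antipJ_l k_char0 chi_dual sum_ee _ w0).
have <- := antipJ_l k_char0 chi_dual sum_ee (w := wop) a wop_coc.1.
have <- : pushf (@swap gT) (D a) = DJ (Jw wop) (Jw (fun x y => (wop x y)^-1)) a.
  by rewrite DJ_swap swapJi.
rewrite lext_pushf; apply: eq_lext => x /=.
have e1 : diag_ee (fun y => (wop y^-1%g y)^-1) = diag_ee (fun y => (w y^-1%g y)^-1).
  by apply: eq_diag_ee => y; rewrite /wop (cocycle_xV w_coc).
have e2 : diag_ee (fun y => wop y^-1%g y) = diag_ee (fun y => w y^-1%g y).
  by apply: eq_diag_ee => y; rewrite /wop (cocycle_xV w_coc).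
by rewrite -(lext_gel S) SE /antipJ e1 e2.
Qed.

Variable B : A -> Prop.
Hypothesis B_normal : is_normal_sub J Ji S B.
Local Notation N := (invker_group B).

Lemma invker_commute y : {in H :&: N, forall h, chi y h = 1} ->
  exists t, [/\ t \in H, forall x, chi x t = alt w x y & N \subset 'C[t]%g].
Proof.
move=> yN; have [t [tH ty wt]] := alt_grouplike k_char0 chi_dual sum_ee y w_coc.
exists t; split => //; apply: invker_sub_support => b0 g Bb0.
apply: (commuting_support Jw_twist B_normal) Bb0 _ => [b Bb|].
  (* The extension of [y] to [HN] by zero elsewhere, up to the factor of the order of [H :&: N]. It
     is nonzero at 1 because [y] is trivial on [H :&: N]. *)
  pose f (g : gT) : k^o := \sum_(h in H) chi y h * ((h^-1 * g)%g \in N)%:R.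
  have Vf : invfun B f.
    have Vs r : invfun B (fun g => \sum_(h <- r | h \in H) chi y h * ((h^-1 * g)%g \in N)%:R).
      elim: r => [|h r IHr].
        rewrite (_ : (fun g => _) = fun=> 0); first exact: invfun_const.
        by apply/funext => x; rewrite big_nil.
      rewrite (_ : (fun g => _) = fun x => (if h \in H then chi y h else 0) *
          ((h^-1 * x * 1)%g \in N)%:R + \sum_(h <- r | h \in H) chi y h * ((h^-1 * x)%g \in N)%:R).
        apply: invfunD => //.
        by apply: invfunZ; apply: (invfun_indicator Jw_twist S_antip B_normal).
      by apply/funext => x; rewrite big_cons mulg1; case: ifP => // _; rewrite mul0r add0r.
    exact: Vs.
  have fH x h : h \in H -> f (x * h)%g = f x * chi y h.
    move=> hH; rewrite /f mulr_suml (reindex_inj (mulIg h)) /=.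
    apply: eq_big => [h'|h' h'H]; first by rewrite groupMr.
    rewrite (chiMx chi_dual) // ; last by rewrite groupMr in h'H.
    rewrite mulrAC invMg !mulgA; congr (_ * (nat_of_bool _)%:R * _).
    rewrite -[in RHS](memJ_norm _ (_ : h \in 'N(N)%g)) ?conjgE ?mulgA //.
    by apply: subsetP (normal_norm (invker_normal Jw_twist S_antip B_normal)) _ _; rewrite inE.
  have f1 : (f 1%g : k) != 0.
    rewrite /f (bigID [in N]) /= [X in _ + X]big1 ?addr0 => [|h /andP [_ hN]]; last first.
      by rewrite mulg1 groupV (negbTE hN) mulr0.
    rewrite (eq_bigr (fun=> 1)) => [|h /andP [hH hN]]; last first.
      by rewrite mulg1 groupV hN mulr1 yN // in_setI hH.
    rewrite (eq_bigl [in H :&: N]) => [|h]; last by rewrite in_setI.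
    by rewrite sumr_const (natH_neq0 k_char0 [group of H :&: N]).
  have [n [c [d [Bcd Db]]]] := sub_cop B_normal Bb.
  have e1 := slice_invfun Jw_twist S_antip B_normal Vf (cop_DJ JK b) Db
    (fun i => (Bcd i).2) (twist_counR Jw_twist b).
  pose Ji' := Jw (fun x y => (wop x y)^-1).
  have JK' : Jw wop * Ji' = 1 by case: (Jw_inv k_char0 chi_dual sum_ee wop_coc.1).
  have Db' : DJ (Jw wop) Ji' b = \sum_(i < n) tens (d i) (c i).
    rewrite -[Ji']swapJi -DJ_swap Db (linear_sum (pushf (@swap gT))).
    by apply: eq_bigr => i _; rewrite /= pushf_swap_tens.
  have e2 := slice_invfun Jw_twist S_antip B_normal Vf (cop_DJ JK' b) Db' (fun i => (Bcd i).1).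
  rewrite -[Ji']swapJi -DJ_swap (twist_counL Jw_twist) in e2; have {}e2 := e2 erefl.
  rewrite (slice_twist k_char0 chi_dual _ _ fH) (slice_one k_char0 chi_dual _ fH) in e1.
  rewrite (slice_twist k_char0 chi_dual _ _ fH) (slice_one k_char0 chi_dual _ fH) in e2.
  rewrite -/(diag_ee (w y)) in e2.
  have wy : diag_ee (fun x => (w y x)^-1) * diag_ee (w y) = 1.
    by apply: (diag_ee_unit k_char0 chi_dual sum_ee) => x; rewrite mulVf.
  (* Both slices contain the same pointwise product of [b] and [f]; eliminating it leaves the
     commutation of [b] with [t], up to the invertible factor [diag_ee (w y)]. *)
  have {}e1 : diag_ee (w y) * b * gel k t = diag_ee (w y) * gel k t * b.
    by apply: (@scalerI k A _ f1); move: e1; rewrite -wt mulrA e2 -!scalerAl.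
  by rewrite -[LHS]mul1r -[RHS]mul1r -wy -!mulrA (mulrA (diag_ee (w y))) e1 -mulrA.
(* Both the twist and [t (x) 1] are diagonal on the eigenvectors [dtens x z]. *)
apply: (dtens_ext sum_ee) => x z; rewrite -!mulrA (Jw_dtens k_char0 chi_dual).
rewrite dtensE tensM (gel_ee chi_dual) // mul1r tensZl -!scalerAr -dtensE.
rewrite (Jw_dtens k_char0 chi_dual) dtensE tensM (gel_ee chi_dual) // mul1r tensZl.
by rewrite !scalerA mulrC.
Qed.

End TwistedSubalgebra.

(** * Nondegeneracy of the alternating bicharacter *)

Section Eigenvector.
Variables (k : closedFieldType) (V : lmodType k) (T : {linear V -> V}).

Definition poly_act (p : {poly k}) (v : V) : V := \sum_(i < size p) p`_i *: iter i T v.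

Lemma poly_act_widen n (p : {poly k}) v : (size p <= n)%N ->
  poly_act p v = \sum_(i < n) p`_i *: iter i T v.
Proof.
move=> le_pn; rewrite /poly_act (big_ord_widen n (fun i => p`_i *: iter i T v)) //.
rewrite big_mkcond; apply: eq_bigr => i _; case: ifPn => //; rewrite -leqNgt => le_pi.
by rewrite nth_default ?scale0r.
Qed.

Lemma poly_actMX (p : {poly k}) a v : poly_act (p * ('X - a%:P)) v = poly_act p (T v - a *: v).
Proof.
have szM : (size (p * ('X - a%:P))%R <= (size p).+1)%N.
  by apply: leq_trans (size_polyMleq _ _) _; rewrite size_XsubC addn2.
rewrite (poly_act_widen v szM) /poly_act.
under eq_bigr => i _ do rewrite mulrBr coefB coefMX coefMC scalerBl.
rewrite sumrB big_ord_recl /= scale0r add0r [X in _ - X]big_ord_recr /=.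
rewrite nth_default // mul0r scale0r addr0 -sumrB; apply: eq_bigr => i _.
have iterB n u u' : iter n T (u - u') = iter n T u - iter n T u'.
  by elim: n => //= n ->; rewrite linearB.
have iterZ n c u : iter n T (c *: u) = c *: iter n T u.
  by elim: n => //= n ->; rewrite linearZ.
by rewrite iterB iterZ scalerBr scalerA -iterSr.
Qed.

(** Over a closed field [p] splits; apply its linear factors in turn until one kills the current
    vector. The invariant property [P] is carried along so that the eigenvector can satisfy further
    conditions. *)
Lemma exists_eigenvector (P : V -> Prop) p v :
  (forall u a, P u -> P (T u - a *: u)) -> P v -> v != 0 -> p != 0 -> poly_act p v = 0 ->
  exists a u, [/\ P u, u != 0 & T u = a *: u].
Proof.
move=> PT; have [rs ->] := closed_field_poly_normal p.
set c := lead_coef _ => Pv v0; elim: rs v Pv v0 => [|a rs IHrs] v Pv v0.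
  rewrite big_nil alg_polyC polyC_eq0 => c0; rewrite /poly_act size_polyC c0 big_ord1 coefC /=.
  by move/eqP; rewrite scaler_eq0 (negbTE c0) (negbTE v0).
rewrite big_cons mulrC scalerAl => pa0; rewrite poly_actMX.
case: (eqVneq (T v - a *: v) 0) => [/eqP|Tv0].
  by rewrite subr_eq0 => /eqP Tv _; exists a, v.
apply: IHrs => //; first exact: PT.
by apply: contraNneq pa0 => ->; rewrite mul0r.
Qed.

End Eigenvector.

(** * Symmetric cocycles over an algebraically closed field *)

Section SymmetricCocycle.
Variables (k : closedFieldType) (X : finGroupType) (w : X -> X -> k).
Hypothesis w_coc : is_2cocycle w.
Local Notation V := {ffun X -> k^o}.

Let w0 x y : w x y != 0. Proof. by case: w_coc. Qed.

(* Left multiplication by [x] in the twisted group algebra [k_w X]. *)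
Definition twmul x (v : V) : V := [ffun y => w x (x^-1 * y)%g * v (x^-1 * y)%g].

Lemma twmul_linear x : linear (twmul x).
Proof.
move=> c u v; apply/ffunP => y; rewrite !ffunE /GRing.scale /= mulrDr.
by rewrite mulrCA.
Qed.
HB.instance Definition _ x := GRing.isLinear.Build k V V _ (twmul x) (twmul_linear x).

Lemma twmulM x y v : twmul x (twmul y v) = w x y *: twmul (x * y)%g v.
Proof.
apply/ffunP => z; rewrite !ffunE /GRing.scale /= !mulrA invMg -!mulgA; congr (_ * _).
have := w_coc.2 x y (y^-1 * (x^-1 * z))%g; rewrite mulKVg => ->.
by rewrite mulrC.
Qed.

Lemma twmul1 v : twmul 1%g v = w 1%g 1%g *: v.
Proof.
by apply/ffunP => z; rewrite !ffunE invg1 mul1g (cocycle_1x w_coc).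
Qed.

Lemma twmul_iter x i v : exists c, c != 0 /\ iter i (twmul x) v = c *: twmul (x ^+ i)%g v.
Proof.
elim: i => [|i [c [c0 IHi]]] /=.
  exists (w 1%g 1%g)^-1; rewrite invr_neq0 //; split => //.
  by rewrite expg0 twmul1 scalerA mulVf // scale1r.
exists (c * w x (x ^+ i)%g); rewrite mulf_neq0 //; split => //.
by rewrite IHi linearZ /= twmulM scalerA -expgS.
Qed.

Hypothesis w_sym : forall x y, w x y = w y x.
Hypothesis X_ab : forall x y : X, (x * y)%g = (y * x)%g.

Lemma common_twmul_eigenvector (s : seq X) :
  exists v : V, v != 0 /\ forall x, x \in s -> exists a, twmul x v = a *: v.
Proof.
elim: s => [|x s [v [v0 vs]]].
  exists [ffun=> 1]; split => //.
  by apply/eqP => /ffunP /(_ 1%g); rewrite !ffunE => /eqP; rewrite oner_eq0.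
have [c [c0 xn]] := twmul_iter x #[x]%g v.
(* The power of [twmul x] at the order of [x] multiplies [v] by [d], which gives an annihilating
   polynomial. [P] keeps the eigenvectors already found; it is preserved because symmetry makes the
   operators commute. *)
pose d := c * w 1%g 1%g; pose P u := forall z, z \in s -> exists a, twmul z u = a *: u.
have n_gt0 : (0 < #[x]%g)%N by apply: order_gt0.
have := @exists_eigenvector k V (twmul x) P ('X^#[x]%g - d%:P) v.
case=> // [u a Pu z /Pu [b zb]||| a [u [Pu u0 xu]]].
- exists b; rewrite linearB linearZ /= zb -linearZ_LR /= twmulM w_sym X_ab -twmulM zb.
  by rewrite linearZ scalerBr !scalerA mulrC.
- by rewrite -size_poly_eq0 size_XnsubC.
- rewrite /poly_act size_XnsubC //.
  under eq_bigr => i _ do rewrite coefB coefXn coefC scalerBl.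
  rewrite sumrB big_ord_recr /= eqxx scale1r [X in X + _ - _]big1 ?add0r => [|i _]; last first.
    by rewrite ltn_eqF ?scale0r.
  rewrite big_ord_recl /= big1 => [|i _]; last by rewrite scale0r.
  by rewrite addr0 xn expg_order twmul1 scalerA subrr.
exists u; split => // z; rewrite inE => /predU1P [-> | /Pu //].
by exists a.
Qed.

(** The eigenvalues on a common eigenvector form a one-dimensional representation of the twisted
    group algebra, and they trivialize [w]. *)
Lemma symmetric_coboundary : is_2coboundary w.
Proof.
have [v [v0 vX]] := common_twmul_eigenvector (enum X).
have {}vX x : exists a, twmul x v = a *: v by apply: vX; rewrite mem_enum.
have /choice [f fE] := vX.
have ff x y : f x * f y = w x y * f (x * y)%g.
  have : (f x * f y) *: v = (w x y * f (x * y)%g) *: v.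
    by rewrite mulrC -!scalerA -!fE -twmulM [in RHS]fE linearZ.
  by move=> /eqP; rewrite -subr_eq0 -scalerBl scaler_eq0 (negbTE v0) orbF subr_eq0 => /eqP.
have f1 : f 1%g = w 1%g 1%g.
  have : (f 1%g - w 1%g 1%g) *: v = 0 by rewrite scalerBl -fE twmul1 subrr.
  by move/eqP; rewrite scaler_eq0 (negbTE v0) orbF subr_eq0 => /eqP.
have f0 x : f x != 0.
  apply/eqP => fx0; have /eqP := ff x x^-1%g.
  by rewrite fx0 mul0r mulgV f1 eq_sym mulf_eq0 !(negbTE (w0 _ _)).
by exists f; split => // x y; rewrite ff mulfK.
Qed.

End SymmetricCocycle.

(** If [y] were nontrivial in the radical, then for [v] outside the cyclic group of [y] the kernel
    of [alt w ^~ v] would contain both [y] and [v], hence be everything in order [q^2]. So [alt]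
    would be trivial and [w] symmetric, hence a coboundary. *)
Lemma nondegenerate_alt (k : closedFieldType) (X : finGroupType) (w : X -> X -> k) q y :
  is_2cocycle w -> (forall x z : X, (x * z)%g = (z * x)%g) -> ~ is_2coboundary w ->
  prime q -> #|X| = (q ^ 2)%N -> (forall x, alt w x y = 1) -> y = 1%g.
Proof.
move=> w_coc X_ab w_nc q_pr cX ay; apply/eqP; apply: contraPT w_nc => y1 w_nc; apply: w_nc.
apply: symmetric_coboundary => // x z.
have altg t : group_set [set x | alt w x t == 1].
  apply/group_setP; split => [|u v]; rewrite !inE; last first.
    by move=> /eqP uz /eqP vz; rewrite altM // uz vz mulr1.
  by rewrite /alt (cocycle_x1 w_coc) (cocycle_1x w_coc) divff // w_coc.1.
have cX' : #|[set: X]| = (q ^ 2)%N by rewrite cardsT.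
have full (K : {group X}) u : y \in K -> u \in K -> u \notin <[y]>%g -> K :=: [set: X].
  move=> yK uK uy; apply/eqP; rewrite eqEcard subsetT cX' /=.
  have yK' : (<[y]> \proper K)%g.
    by rewrite properE cycle_subG yK; apply/subsetPn; exists u.
  have /(dvdn_pfactor _ _ q_pr) [m _ cK] : (#|K| %| q ^ 2)%N by rewrite -cX' cardSg ?subsetT.
  have /(dvdn_pfactor _ _ q_pr) [n _ cy] : (#|<[y]>%g| %| q ^ 2)%N by rewrite -cX' cardSg ?subsetT.
  have := proper_card yK'; rewrite cK cy ltn_exp2l ?prime_gt1 // => nm.
  have n0 : n != 0%N by apply: contraNneq y1 => n0; rewrite -cycle_eq1 trivg_card1 cy n0.
  by rewrite leq_exp2l; [lia | apply: prime_gt1].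
have yK t : y \in Group (altg t) by rewrite inE altC ay invr1.
have altT t v : alt w t v = 1.
  case: (boolP (v \in <[y]>%g)) => [/cycleP [n ->]|vy].
    rewrite altC; elim: n => [|n IHn].
      by rewrite expg0 /alt (cocycle_x1 w_coc) (cocycle_1x w_coc) divff ?w_coc.1 ?invr1.
    by rewrite expgS altM // invfM IHn mulr1 -altC ay.
  have vv : v \in Group (altg v) by rewrite inE altxx.
  by have /setP /(_ t) := full _ v (yK v) vv vy; rewrite !inE => /eqP.
by have /divr1_eq := altT x z.
Qed.

(** * Normal subgroups of the product group *)

Section GroupTheory.
Local Open Scope group_scope.

Lemma dvdn_prime_pred_lt (p q : nat) : prime p -> (q %| p.-1)%N -> (q < p)%N.
Proof. by move=> /prime_gt1 p1 /dvdn_leq; lia. Qed.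

Lemma normal_TI_cent (gT : finGroupType) (G K L : {group gT}) :
  K <| G -> L <| G -> K :&: L = 1 -> K \subset 'C(L).
Proof.
move=> /andP [sKG nKG] /andP [sLG nLG] KL; apply/commG1P/trivgP; rewrite -KL.
by apply: commg_subI; rewrite subsetI subxx /=; apply: subset_trans; eassumption.
Qed.

(* What the proof needs of a nonabelian group of order [p q], with [p] left
   out so that the two factors of the group can be exchanged. *)
Record pq_like (gT : finGroupType) (q : nat) (G : {group gT}) : Prop := PqLike {
  pq_center : forall x, x \in G -> x \in 'C(G) -> x = 1;
  pq_free : forall M : {group gT}, M <| G -> M :!=: 1 ->
    forall t, t \in G -> (#[t] %| q)%N -> M \subset 'C[t] -> t = 1;
  pq_full : forall M Q : {group gT}, M <| G -> M :!=: 1 -> Q \subset M -> #|Q| = q -> G \subset M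
}.

(** The Sylow [p]-subgroup is normal and self-centralizing, so every nontrivial normal subgroup
    contains it; the three properties follow. *)
Lemma pq_likeP (gT : finGroupType) (p q : nat) (G : {group gT}) :
  prime p -> prime q -> (q %| p.-1)%N -> #|G| = (p * q)%N -> ~~ abelian G -> pq_like q G.
Proof.
move=> p_pr q_pr q_dvd cG nab.
have q_lt_p := dvdn_prime_pred_lt p_pr q_dvd.
have co_pq : coprime p q by rewrite prime_coprime // dvdn_prime2 // gtn_eqF.
have [P sylP] := Sylow_exists p G.
have cP : #|P| = p.
  rewrite (card_Hall sylP) cG partnM ?prime_gt0 // part_pnat_id ?pnat_id //.
  by rewrite part_p'nat ?muln1 // p'natE // -prime_coprime.
have pP : prime #|P| by rewrite cP.
have sPG := pHall_sub sylP.
have nPG : P <| G.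
  suff /normal_sylowP [P' sylP' nP'] : #|'Syl_p(G)| == 1%N.
    have [x xG ->] := Sylow_trans sylP' sylP.
    by rewrite /= (normsP (normal_norm nP')).
  have : (#|'Syl_p(G)| %| q)%N.
    rewrite (card_Syl sylP) -(@dvdn_pmul2l #|P|) ?cardG_gt0 // {2}cP -cG.
    rewrite -(Lagrange (subsetIl G 'N(P))) dvdn_pmul2r ?indexg_gt0 //.
    by rewrite cardSg // subsetI sPG normG.
  have /primeP [_ qd] := q_pr; move/qd/orP => [//|/eqP Sq].
  have := card_Syl_mod G p_pr; rewrite Sq modn_small // => q1.
  by rewrite q1 in q_pr.
have cCP : 'C_G(P) = P.
  have abP : abelian P by rewrite cyclic_abelian // prime_cyclic.
  have sPC : P \subset 'C_G(P) by rewrite subsetI sPG.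
  have dC : (#|'C_G(P) : P| %| q)%N.
    rewrite -(@dvdn_pmul2l #|P|) ?cardG_gt0 // Lagrange // cP -cG.
    by rewrite cardSg ?subsetIl.
  have /primeP [_ qd] := q_pr; move/qd: dC => /orP [|/eqP dC].
    by rewrite indexg_eq1 => CP; apply/eqP; rewrite eqEsubset CP.
  (* If the centralizer were larger than [P], then [P] would be central with cyclic quotient, and
     [G] would be abelian. *)
  have CG : 'C_G(P) = G.
    by apply/eqP; rewrite eqEcard subsetIl cG -(Lagrange sPC) dC cP leqnn.
  case/negP: nab; apply: (@cyclic_factor_abelian _ P).
    by rewrite subsetI sPG centsC -{1}CG subsetIr.
  by rewrite prime_cyclic // card_quotient ?normal_norm // -divgS // cG cP mulKn ?prime_gt0.
have sub (M : {group gT}) : M <| G -> M :!=: 1 -> P \subset M.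
  move=> nMG M1; apply: contraR M1 => /(prime_TIg pP) PM.
  have MC : M \subset P.
    by rewrite -cCP subsetI (normal_sub nMG) (normal_TI_cent nMG nPG) // setIC.
  by rewrite -(setIidPr MC) PM.
have P1 : P :!=: 1 by rewrite -cardG_gt1 cP prime_gt1.
have free t : t \in G -> (#[t] %| q)%N -> P \subset 'C[t] -> t = 1.
  move=> tG tq Pt; have tP : t \in P.
    by rewrite -cCP inE tG -sub_cent1.
  have := order_dvdG tP; rewrite cP => tp.
  have : (#[t] %| 1)%N by rewrite -(eqP co_pq) dvdn_gcd tp.
  by rewrite dvdn1 order_eq1 => /eqP.
split.
- move=> x xG xC; case: (eqVneq x 1) => // x1.
  have xZ : x \in 'Z(G) by rewrite inE xG.
  have : P \subset 'Z(G).
    by apply: sub; [apply: center_normal | apply/trivgPn; exists x].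
  rewrite subsetI centsC => /andP [_ GP].
  have : 'C_G(P) = G by apply/setIidPl.
  rewrite cCP => PG; move: cG; rewrite -PG cP => e.
  move/eqP: e; rewrite -{1}[p]muln1 eqn_pmul2l ?prime_gt0 // => /eqP q1.
  by rewrite -q1 in q_pr.
- move=> M nM M1 t tG tq Mt; apply: free => //.
  by apply: subset_trans Mt; apply: sub.
move=> M Q nM M1 QM cQ; suff /eqP -> : M :==: G by [].
rewrite eqEcard (normal_sub nM) cG dvdn_leq ?cardG_gt0 // Gauss_dvd // -{1}cP -cQ.
by rewrite !cardSg // sub.
Qed.

Section Decomposition.
Variables (gT : finGroupType) (G1 G2 : {group gT}) (q : nat).
Hypotheses (q_pr : prime q) (G_def : G1 \x G2 = [set: gT]).
Hypotheses (pq1 : pq_like q G1) (pq2 : pq_like q G2).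
Variables (H N : {group gT}).
Hypotheses (cQ1 : #|H :&: G1| = q) (cQ2 : #|H :&: G2| = q).
Hypothesis H_def : (H :&: G1) * (H :&: G2) = H.
Hypothesis nN : N <| [set: gT].
(** What the Hopf side supplies: [t] is dual to a nontrivial character trivial on [M], and that
    character is trivial on [t] too because the bicharacter alternates. *)
Hypothesis HN : forall M : {group gT}, M \proper H -> H :&: N \subset M ->
  exists t, [/\ t \in H, t != 1, N \subset 'C[t] & M <*> <[t]> \proper H].

Let cG12 : G2 \subset 'C(G1). Proof. by case/dprodP: G_def. Qed.
Let mulG12 : G1 * G2 = [set: gT]. Proof. by case/dprodP: G_def. Qed.

Let nNG1 : N :&: G1 <| G1.
Proof. by rewrite setIC; apply: normalGI (subsetT _) nN. Qed.

(** [t2] commutes with [G1], so [t1] alone centralizes the nontrivial normal subgroup [N :&: G1]. *)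
Lemma comp_trivial t1 t2 : t1 \in H :&: G1 -> t2 \in H :&: G2 -> N \subset 'C[t1 * t2] ->
  N :&: G1 :!=: 1 -> t1 = 1.
Proof.
move=> t1Q t2Q Nt N1; have [/setIP [_ t1G] /setIP [_ t2G]] := (t1Q, t2Q).
apply: (pq_free pq1 nNG1 N1) => //; first by rewrite -cQ1 order_dvdG.
apply/subsetP => x /setIP [xN xG]; apply/cent1P.
have /cent1P xt := subsetP Nt x xN.
have xt2 : commute x t2 by apply/esym/(centsP cG12).
by apply: (mulIg t2); rewrite -!mulgA xt2 (mulgA t1); exact: xt.
Qed.

Let sub_factor : N :&: G2 = 1 -> N \subset G1.
Proof.
move=> N2; have [nG1 nG2] := dprod_normal2 G_def.
have NC : N \subset 'C(G2) by apply: normal_TI_cent nN nG2 N2.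
apply/subsetP => x xN; have := in_setT x; rewrite -mulG12 => /mulsgP [x1 x2 x1G x2G xE].
suff x2_1 : x2 = 1 by rewrite xE x2_1 mulg1.
apply: (pq_center pq2) => //; have -> : x2 = x1^-1 * x by rewrite xE mulKg.
have cG21 : G1 \subset 'C(G2) by rewrite centsC.
by apply: groupM; rewrite ?groupV; [apply: (subsetP cG21) | apply: (subsetP NC)].
Qed.

(** Here [N] lies in [G1]. Taking [M = H :&: G1] yields a [t] with trivial first component, which
    generates [H :&: G2]; together with [M] it generates all of [H]. *)
Lemma factor_contradiction : N :!=: 1 -> N :&: G2 = 1 -> False.
Proof.
move=> N1 N2; have NG1 := sub_factor N2.
have MH : [group of H :&: G1] \proper H.
  rewrite properEcard subsetIl /= cQ1 -{1}H_def TI_cardMg ?cQ1 ?cQ2.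
    by rewrite ltn_Pmull ?prime_gt1 ?prime_gt0.
  by apply/trivgP; have [_ _ _ <-] := dprodP G_def; apply: setISS; apply: subsetIr.
have [t [tH t1 Nt Mt]] := HN MH (setIS _ NG1).
have := tH; rewrite -{1}H_def => /mulsgP [t1' t2 t1Q t2Q tE].
have t1'1 : t1' = 1.
  by apply: (comp_trivial t1Q t2Q); rewrite -?tE //; rewrite (setIidPl NG1).
have tQ : <[t]> = H :&: G2.
  apply/eqP; rewrite eqEcard cycle_subG tE t1'1 mul1g t2Q cQ2 /=.
  have : (#[t2] %| q)%N by rewrite -cQ2 order_dvdG.
  have /primeP [_ qd] := q_pr; move/qd => /orP [|/eqP <- //].
  by rewrite order_eq1 => /eqP t2_1; rewrite tE t1'1 t2_1 mulg1 eqxx in t1.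
case/andP: Mt => _ /negP []; rewrite tQ -{1}H_def mulG_subG joing_subl.
exact: joing_subr.
Qed.

End Decomposition.

(** A nontrivial [N] meets both factors. If it contains [H], it contains both factors by [pq_full];
    otherwise [M = H :&: N] gives a [t] whose two components are both trivial. *)
Lemma normal_sub_trichotomy (gT : finGroupType) (G1 G2 H N : {group gT}) (q : nat) :
  prime q -> G1 \x G2 = [set: gT] -> pq_like q G1 -> pq_like q G2 ->
  #|H :&: G1| = q -> #|H :&: G2| = q -> (H :&: G1) * (H :&: G2) = H -> N <| [set: gT] ->
  (forall M : {group gT}, M \proper H -> H :&: N \subset M ->
    exists t, [/\ t \in H, t != 1, N \subset 'C[t] & M <*> <[t]> \proper H]) ->
  N :=: 1 \/ N :=: [set: gT].
Proof.
move=> q_pr G_def pq1 pq2 cQ1 cQ2 H_def nN HN.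
case: (eqVneq N 1%G) => [->|N1]; [by left | right].
have G_def' : G2 \x G1 = [set: gT] by rewrite dprodC.
have H_def' : (H :&: G2) * (H :&: G1) = H.
  by rewrite -[RHS]H_def; apply/esym/comm_group_setP; rewrite H_def groupP.
have N1' : N :!=: 1 by [].
case: (eqVneq (N :&: G2) 1) => [N2|N2].
  by case: (factor_contradiction q_pr G_def pq1 pq2 cQ1 cQ2 H_def nN HN N1' N2).
case: (eqVneq (N :&: G1) 1) => [N3|N3].
  by case: (factor_contradiction q_pr G_def' pq2 pq1 cQ2 cQ1 H_def' nN HN N1' N3).
case: (boolP (H \subset N)) => [HsN|HnN].
  have full (G Q : {group gT}) : pq_like q G -> N :&: G != 1 -> #|H :&: G| = q -> G \subset N.
    move=> pqG NG cQ; have nNG : N :&: G <| G by rewrite setIC; apply: normalGI (subsetT _) nN.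
    by apply: subset_trans (pq_full pqG nNG NG (setSI G HsN) cQ) (subsetIl _ _).
  apply/eqP; rewrite eqEsubset subsetT -(dprodW G_def) mulG_subG.
  by rewrite !(full _ H).
have HNH : [group of H :&: N] \proper H by rewrite properE subsetIl subsetI subxx.
have [t [tH t1 Nt _]] := HN _ HNH (subxx _).
have := tH; rewrite -{1}H_def => /mulsgP [t1' t2 t1Q t2Q tE].
have t1'1 : t1' = 1.
  by apply: (comp_trivial G_def pq1 cQ1 nN t1Q t2Q); rewrite -?tE.
have t2_1 : t2 = 1.
  apply: (comp_trivial G_def' pq2 cQ2 nN t2Q t1Q) => //.
  by rewrite t1'1 mulg1 -[t2]mul1g -t1'1 -tE.
by rewrite tE t1'1 t2_1 mulg1 eqxx in t1.
Qed.

End GroupTheory.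

(** * Simplicity *)

Section DefsAsGalg.
Variables (k : fieldType) (gT : finGroupType).
Local Notation A := (galg k gT).
Local Notation A2 := (galg k (gT * gT)%type).

Lemma kG_scaleE c (a : kG k gT) : kG_scale c a = c *: (a : A).
Proof. by apply/ffunP => g; rewrite [LHS]ffunE galgZE. Qed.

Lemma linextE (S : gT -> kG k gT) a : linext S a = lext (S : gT -> A) a.
Proof.
by apply/ffunP => g; rewrite [LHS]ffunE galg_sumE; apply: eq_bigr => x _; rewrite galgZE.
Qed.

Lemma mSidE (S : gT -> kG k gT) (T : kG2 k gT) :
  mSid S T = lext (fun x : gT * gT => (S x.1 : A) * gel k x.2) T.
Proof.
by apply/ffunP => g; rewrite [LHS]ffunE galg_sumE; apply: eq_bigr => x _; rewrite galgZE.
Qed.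

Lemma midSE (S : gT -> kG k gT) (T : kG2 k gT) :
  midS S T = lext (fun x : gT * gT => gel k x.1 * (S x.2 : A)) T.
Proof.
by apply/ffunP => g; rewrite [LHS]ffunE galg_sumE; apply: eq_bigr => x _; rewrite galgZE.
Qed.

Lemma adjE (J Ji : kG2 k gT) (S : gT -> kG k gT) (a x : kG k gT) :
  adj J Ji S a x = adjact J Ji S a x.
Proof.
apply/ffunP => g; rewrite [LHS]ffunE galg_sumE DeltaJE.
by apply: eq_bigr => y _; rewrite galgZE.
Qed.

Lemma in_tensor2E (B : kG k gT -> Prop) (T : kG2 k gT) : in_tensor2 B T ->
  exists n (b c : 'I_n -> A), (forall i, B (b i) /\ B (c i)) /\
    (T : A2) = \sum_(i < n) tens (b i) (c i).
Proof.
move=> [n [b [c [Bbc ->]]]]; exists n, b, c; split => //.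
by apply/ffunP => x; rewrite [LHS]ffunE galg_sumE; apply: eq_bigr => i _; rewrite tensE.
Qed.

End DefsAsGalg.

Lemma mul_inv_uniq (R : nzRingType) (a b c : R) : a * b = 1 -> c * a = 1 -> b = c.
Proof. by move=> ab ca; rewrite -[b]mul1r -ca -mulrA ab mulr1. Qed.

(** The sum [E] of the idempotents satisfies [(E (x) 1) J = J]; cancel [J] and apply the counit to
    the second leg. *)
Lemma twist_inv_sum_ee (k : fieldType) (gT : finGroupType) (H : {group gT}) (X : finGroupType)
  (chi : X -> gT -> k) (w : X -> X -> k) (T : galg k (gT * gT)%type) :
  [pchar k] =i pred0 -> dual_group_param H chi -> Jw H chi w * T = 1 -> \sum_x ee H chi x = 1.
Proof.
move=> k0 chi_dual JT; set E := \sum_x _.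
have Eee x : E * ee H chi x = ee H chi x.
  rewrite mulr_suml (bigD1 x) //= big1 ?addr0 => [|y /negbTE yx];
    by rewrite (ee_orth k0 chi_dual) ?eqxx ?scale1r ?yx ?scale0r.
have EJ : tens E 1 * Jw H chi w = Jw H chi w.
  rewrite /Jw mulr_sumr; apply: eq_bigr => x _; rewrite mulr_sumr; apply: eq_bigr => y _.
  by rewrite -scalerAr tensM Eee mul1r.
have : tens E 1 = 1 :> galg k (gT * gT)%type by rewrite -[LHS]mulr1 -JT mulrA EJ.
move/(congr1 (@counR k gT)); rewrite counR_tens counit1 scale1r => ->; exact: pushf1.
Qed.

(** Compare the coefficients at the identity element in the completeness relation. *)
Lemma card_dual (k : fieldType) (gT : finGroupType) (H : {group gT}) (X : finGroupType)
  (chi : X -> gT -> k) : [pchar k] =i pred0 -> dual_group_param H chi ->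
  \sum_x ee H chi x = 1 -> #|X| = #|H|.
Proof.
move=> k0 chi_dual /ffunP /(_ 1%g); rewrite galg_sumE -gel1 gelE eqxx.
rewrite (eq_bigr (fun=> #|H|%:R^-1)) => [|x _]; last first.
  by rewrite ffunE group1 invg1 (chix1 chi_dual) mulr1.
rewrite sumr_const -(mulr_natl #|H|%:R^-1) => /(congr1 (fun c => c * #|H|%:R)) /=.
rewrite divfK ?natH_neq0 // mul1r => XH.
have natr0 n : (n%:R == 0 :> k) = (n == 0%N) by move/pcharf0P: k0; apply.
have sub0 m n : m%:R = n%:R :> k -> (m - n)%N = 0%N.
  move=> mn; case: (leqP n m) => [nm|/ltnW]; last by move/eqP.
  by apply/eqP; rewrite -natr0 natrB // mn subrr.
by apply/eqP; rewrite eqn_leq -!subn_eq0 !sub0.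
Qed.

Theorem theorem4p4
  (k : closedFieldType) (k_char0 : [pchar k] =i pred0)
  (p q r : nat) (p_pr : prime p) (q_pr : prime q) (r_pr : prime r)
  (q_dvd_p1 : (q %| p.-1)%N) (q_dvd_r1 : (q %| r.-1)%N)
  (gT : finGroupType) (G1 G2 : {group gT})
  (G1_ord : #|G1| = (p * q)%N) (G1_nab : ~~ abelian G1)
  (G2_ord : #|G2| = (r * q)%N) (G2_nab : ~~ abelian G2)
  (G_def : (G1 \x G2)%g = [set: gT])
  (H : {group gT}) (H_iso : (H \isog [set: 'Z_q * 'Z_q])%g)
  (X : finGroupType) (chi : X -> gT -> k) (chi_dual : dual_group_param H chi)
  (omega : X -> X -> k) (omega_coc : is_2cocycle omega)
  (omega_nontriv : ~ is_2coboundary omega)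
  (Jinv : kG2 k gT)
  (Jinv_r : kG2_mul (twistJ H chi omega) Jinv = kG2_one k gT)
  (Jinv_l : kG2_mul Jinv (twistJ H chi omega) = kG2_one k gT)
  (S : gT -> kG k gT) (S_antipode : is_antipode (twistJ H chi omega) Jinv S) :
  hopf_simple (twistJ H chi omega) Jinv S.
Proof.
have cH : #|H| = (q ^ 2)%N.
  by rewrite (card_isog H_iso) cardsT card_prod card_ord Zp_cast ?prime_gt1.
rewrite twistJE in Jinv_r Jinv_l S_antipode *; rewrite !kG2_mulE kG2_oneE in Jinv_r Jinv_l.
have sum1 := twist_inv_sum_ee k_char0 chi_dual Jinv_r.
have cX : #|X| = (q ^ 2)%N by rewrite (card_dual k_char0 chi_dual sum1).
pose Ji := Jw H chi (fun x y => (omega x y)^-1).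
have JiE : Jinv = Ji :> galg k (gT * gT)%type.
  have [JK JiK] := Jw_inv k_char0 chi_dual sum1 omega_coc.1.
  by apply: (mul_inv_uniq _ JiK); exact: Jinv_r.
move: S_antipode; rewrite {}JiE => S_antipode {Jinv Jinv_r Jinv_l}.
have S_antip : is_antip (Jw H chi omega) Ji S.
  by split=> a; have [] := S_antipode a; rewrite kG_scaleE DeltaJE mSidE midSE counitE.
have J_twist := Jw_twist k_char0 chi_dual sum1 omega_coc.
move=> B [[[B0 [BD BZ]] B1 BM Bcop BS] Badj].
have B_normal : is_normal_sub (Jw H chi omega) Ji S B.
  split=> //.
  - by move=> a Ba; have := in_tensor2E (Bcop _ Ba); rewrite DeltaJE.
  - by move=> a Ba; rewrite -linextE; apply: BS.
  - by move=> a x Bx; rewrite -adjE; apply: Badj.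
have S_op := antip_op k_char0 chi_dual sum1 omega_coc S_antip.
have nN := invker_normal J_twist S_antip B_normal.
have q_pq1 := pq_likeP p_pr q_pr q_dvd_p1 G1_ord G1_nab.
have q_pq2 := pq_likeP r_pr q_pr q_dvd_r1 G2_ord G2_nab.
have [nG1 nG2] := dprod_normal2 G_def.
have q'prime s : prime s -> (q %| s.-1)%N -> (s`_q = 1)%N.
  move=> s_pr q_s; rewrite part_p'nat // p'natE // dvdn_prime2 //.
  by rewrite ltn_eqF // dvdn_prime_pred_lt.
(* As a Sylow [q]-subgroup, [H] meets each normal factor in a subgroup of order [q], hence is the
   product of these two intersections. *)
have sylH : (q.-Sylow([set: gT]) H)%g.
  rewrite pHallE subsetT cH -(dprod_card G_def) G1_ord G2_ord.
  rewrite !partnM ?muln_gt0 ?prime_gt0 // (q'prime p) // (q'prime r) // !mul1n.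
  by rewrite !part_pnat_id ?pnat_id //= mulnn.
have cQ (G : {group gT}) s : prime s -> (q %| s.-1)%N -> (G <| [set: gT])%g -> #|G| = (s * q)%N ->
    #|H :&: G| = q.
  move=> s_pr q_s nG cG; rewrite (card_Hall (Hall_setI_normal nG sylH)) cG.
  by rewrite partnM ?prime_gt0 // (q'prime s) // mul1n part_pnat_id ?pnat_id.
have cQ1 := cQ _ _ p_pr q_dvd_p1 nG1 G1_ord; have cQ2 := cQ _ _ r_pr q_dvd_r1 nG2 G2_ord.
have H_def : ((H :&: G1) * (H :&: G2))%g = H.
  have Q12 : ((H :&: G1) :&: (H :&: G2) = 1)%g.
    by apply/trivgP; have [_ _ _ <-] := dprodP G_def; apply: setISS; apply: subsetIr.
  by apply/eqP; rewrite eqEcard mul_subG ?subsetIl // TI_cardMg // cQ1 cQ2 cH mulnn /=.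
have [|N1|NT] := @normal_sub_trichotomy _ G1 G2 H [group of invker B] q q_pr G_def
    q_pq1 q_pq2 cQ1 cQ2 H_def nN.
- move=> M MH HNM; have [y y1 yM] := proper_character k_char0 chi_dual sum1 MH.
  have [|t [tH ty Nt]] := invker_commute k_char0 chi_dual sum1 omega_coc S_antip B_normal (y := y).
    by move=> h hHN; apply: yM; apply: (subsetP HNM).
  have ker_group : group_set [set h in H | chi y h == 1].
    apply/group_setP; split=> [|g h]; first by rewrite inE group1 (chix1 chi_dual) eqxx.
    rewrite !inE => /andP [gH /eqP yg] /andP [hH /eqP yh].
    by rewrite groupM // (chiMx chi_dual) // yg yh mulr1 eqxx.
  exists t; split=> //.
    apply: contraNneq y1 => t1; apply/eqP.
    apply: (nondegenerate_alt omega_coc _ omega_nontriv q_pr cX) => [x z|x].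
      exact: (abelian_dual chi_dual).
    by rewrite -ty t1 (chix1 chi_dual).
  (* The kernel of [y] contains [M] by choice of [y], and [t] because [alt y y = 1]; it is proper
     since [y] is nontrivial. *)
  have MK : (M <*> <[t]>)%g \subset Group ker_group.
    rewrite join_subG cycle_subG inE tH ty altxx // eqxx !andbT.
    by apply/subsetP => h hM; rewrite inE (subsetP (proper_sub MH)) //= yM.
  apply: (sub_proper_trans MK).
  rewrite properE; apply/andP; split; first by apply/subsetP => h; rewrite inE => /andP [].
  apply: contra y1 => /subsetP HK; apply/eqP; apply: (chi_inj chi_dual) => h hH.
  by have := HK h hH; rewrite inE (chi1 chi_dual) // => /andP [_ /eqP].
- left=> a; split=> [Ba|[c ->]]; last by apply: BZ.
  exists (counit a); rewrite kG_scaleE.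
  by apply: (invker_trivial J_twist S_antip B_normal) => //; rewrite N1.
(* The remaining case is [N = G]: [B] contains the sum of all group elements, and slices of its
   twisted coproduct span the whole algebra. *)
right; have BL := invker_full J_twist S_antip B_normal S_op k_char0.
have {}BL : B (\sum_g gel k g) by apply: BL; rewrite NT.
have [n [b [c [Bbc Db]]]] := sub_cop B_normal BL.
apply: (sum_gel_generates k_char0 chi_dual sum1 omega_coc Db (fun i => (Bbc i).1)).
- exact: (subD B_normal).
- exact: (subZ B_normal).
exact: (sub0 B_normal).
Qed.
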